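(* Let $p\in[1,+\infty]$ and let $\Omega$ be a nonempty open subset of $\mathbb{R}^N$, of finite measure if $p\in[1,+\infty)$, and arbitrary if $p=+\infty$. Then $W^{1,p}_1(\Omega)=W^{1,p}(\Omega)$, with equivalence of norms.
   Context: Here $W^{1,p}_1(\Omega)$ is the nonlocal Sobolev space for the weight identically equal to $1$ on $\Omega\times\Omega$, defined as follows. For $\psi\in\mathcal{C}^1_c(\Omega\times\Omega)$ and $i=1,\dots,N$ put $$\partial^*_{1,i}(\psi)(x):=\int_\Omega\frac{\partial}{\partial x_i}\left[\psi(y,x)-\psi(x,y)\right]\mathrm{d}y,\quad x\in\Omega.$$ A function $u\in L^1_{\mathrm{loc}}(\Omega)$ has weak $i$-th nonlocal partial derivative (induced by $1$) $\partial_{1,i}u\in L^1_{\mathrm{loc}}(\Omega\times\Omega)$ if $$\int_\Omega u(x)\,\partial^*_{1,i}(\psi)(x)\,\mathrm{d}x=-\int_{\Omega\times\Omega}\partial_{1,i}u(x,y)\,\psi(x,y)\,\mathrm{d}x\,\mathrm{d}y\quad\text{for all }\psi\in\mathcal{C}^1_c(\Omega\times\Omega);$$ it is unique a.e. Put $\nabla_1u:=(\partial_{1,1}u,\dots,\partial_{1,N}u)$. Then $W^{1,p}_1(\Omega):=\{u\in L^p(\Omega):\nabla_1u\in L^p(\Omega\times\Omega;\mathbb{R}^N)\}$ with norm $\|u\|_{L^p(\Omega)}+\|\nabla_1u\|_{L^p(\Omega\times\Omega;\mathbb{R}^N)}$, the $L^p$ norm of a vector field being the $L^p$ norm of its pointwise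 Euclidean norm. $W^{1,p}(\Omega)$ is the classical Sobolev space with norm $\|u\|_{L^p(\Omega)}+\|\nabla u\|_{L^p(\Omega;\mathbb{R}^N)}$. *)

(* Defs.v *)
From HB Require Import structures.
From mathcomp Require Import all_boot all_order all_algebra.
From mathcomp Require Import all_classical all_reals all_analysis.

Set Implicit Arguments.
Unset Strict Implicit.
Unset Printing Implicit Defensive.
Import Order.TTheory GRing.Theory Num.Theory.
Import numFieldNormedType.Exports.

Local Open Scope classical_set_scope.
Local Open Scope ring_scope.

(* R^N is 'rV[R]_N. Its sigma-algebra is generated by the coordinates, as the
   library does for tuples: it is the Borel sigma-algebra. *)
Definition measure_rV_display : measure_display -> measure_display.
Proof. exact. Qed.

Section measurable_rV.
Context {d} {T : measurableType d} (n : nat).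

Let coord : 'I_n -> 'rV[T]_n -> T := fun i v => v ord0 i.

Let rV_set0 : g_sigma_preimage coord set0.
Proof. exact: sigma_algebra0. Qed.

Let rV_setC A : g_sigma_preimage coord A -> g_sigma_preimage coord (~` A).
Proof. exact: sigma_algebraC. Qed.

Let rV_bigcup (F : _^nat) : (forall i, g_sigma_preimage coord (F i)) ->
  g_sigma_preimage coord (\bigcup_i (F i)).
Proof. exact: sigma_algebra_bigcup. Qed.

HB.instance Definition _ := @isMeasurable.Build (measure_rV_display d)
  'rV[T]_n (g_sigma_preimage coord) rV_set0 rV_setC rV_bigcup.

End measurable_rV.

Lemma measurable_coord_rV {d} {T : measurableType d} n (i : 'I_n) :
  measurable_fun [set: 'rV[T]_n] (fun v => v ord0 i).
Proof.
move=> _ Y mY; rewrite setTI; apply: sub_sigma_algebra.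
rewrite -bigcup_seq/=; exists i => /=; first by rewrite mem_index_enum.
by exists Y => //; rewrite setTI.
Qed.

Lemma measurable_fun_rV {d1 d2} {T1 : measurableType d1}
    {T : measurableType d2} n (f : T1 -> 'rV[T]_n) :
  (forall i, measurable_fun [set: T1] (fun x => f x ord0 i)) ->
  measurable_fun [set: T1] f.
Proof.
move=> mf; apply: (@measurability _ _ _ _ _ _
  (\big[setU/set0]_(i < n) preimage_set_system setT
     (fun v : 'rV[T]_n => v ord0 i) measurable)) => //.
move=> _ [B BG <-]; move: BG; rewrite -bigcup_seq/= => -[i _ [Y mY <-]].
by have := mf i measurableT Y mY; rewrite !setTI.
Qed.

Definition row_cons (T : Type) n (xv : T * 'rV[T]_n) : 'rV[T]_n.+1 :=
  \row_i oapp (fun j => xv.2 ord0 j) xv.1 (unlift ord0 i).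

Definition row_uncons (T : Type) n (v : 'rV[T]_n.+1) : T * 'rV[T]_n :=
  (v ord0 ord0, \row_j v ord0 (lift ord0 j)).

Lemma row_consK (T : Type) n : cancel (@row_cons T n) (@row_uncons T n).
Proof.
move=> [x v]; congr pair; first by rewrite mxE unlift_none.
by apply/rowP => j; rewrite !mxE liftK.
Qed.

Lemma measurable_row_cons {d} {T : measurableType d} n :
  measurable_fun [set: T * 'rV[T]_n] (@row_cons T n).
Proof.
apply: measurable_fun_rV => i; rewrite /row_cons.
under eq_fun do rewrite mxE.
case: unliftP => [j _|_] /=; last exact: measurable_fst.
exact: (measurableT_comp (measurable_coord_rV j) measurable_snd).
Qed.

Lemma measurable_row_uncons {d} {T : measurableType d} n :
  measurable_fun [set: 'rV[T]_n.+1] (@row_uncons T n).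
Proof.
apply: measurable_fun_pair; first exact: measurable_coord_rV.
apply: measurable_fun_rV => j.
by under eq_fun do rewrite mxE; exact: measurable_coord_rV.
Qed.

Section lebesgue_rV_cons.
Context {R : realType} (n : nat).
Variable mu : {sigma_finite_measure set 'rV[R]_n -> \bar R}.

Definition lebesgue_rV_cons : set 'rV[R]_n.+1 -> \bar R :=
  pushforward (@lebesgue_measure R \x mu)%E (@row_cons R n).

Let cons0 : lebesgue_rV_cons set0 = 0%E.
Proof. by rewrite /lebesgue_rV_cons /pushforward preimage_set0 measure0. Qed.

Let cons_ge0 A : (0 <= lebesgue_rV_cons A)%E.
Proof. exact: (measure_ge0 (lebesgue_measure \x mu)%E). Qed.

Let cons_sigma_additive : semi_sigma_additive lebesgue_rV_cons.
Proof.
by apply: measure_semi_sigma_additive => ?; exact: measurable_row_cons.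
Qed.

HB.instance Definition _ := isMeasure.Build _ _ _ lebesgue_rV_cons
  cons0 cons_ge0 cons_sigma_additive.

Let sigma_finite_cons : sigma_finite setT lebesgue_rV_cons.
Proof.
have /sigma_finiteP[F [TF ndF Foo]] := sigma_finiteT (@lebesgue_measure R).
have /sigma_finiteP[G [TG ndG Goo]] := sigma_finiteT mu.
exists (fun k => @row_uncons R n @^-1` (F k `*` G k)) => [|k].
  rewrite -preimage_bigcup; apply/esym; rewrite -subTset => v _ /=.
  have [i _ Fi] : (\bigcup_i F i) (row_uncons v).1 by rewrite -TF.
  have [j _ Gj] : (\bigcup_i G i) (row_uncons v).2 by rewrite -TG.
  exists (maxn i j) => //; split.
    by move: Fi; exact/subsetPset/ndF/leq_maxl.
  by move: Gj; exact/subsetPset/ndG/leq_maxr.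
have [mFk Fkoo] := Foo k; have [mGk Gkoo] := Goo k; split.
  by rewrite -[X in measurable X]setTI; apply: measurable_row_uncons => //;
    exact: measurableX.
rewrite /lebesgue_rV_cons /pushforward -comp_preimage.
rewrite (_ : _ \o _ = id); last exact/funext/row_consK.
by rewrite preimage_id product_measure1E// lte_mul_pinfty// ge0_fin_numE.
Qed.

HB.instance Definition _ :=
  @Measure_isSigmaFinite.Build _ _ _ lebesgue_rV_cons sigma_finite_cons.
End lebesgue_rV_cons.

Fixpoint lebesgue_rV {R : realType} (n : nat) :
    {sigma_finite_measure set 'rV[R]_n -> \bar R} :=
  if n is m.+1 then lebesgue_rV_cons (lebesgue_rV m) else \d_ (0 : 'rV[R]_0).

Lemma lebesgue_rV_box {R : realType} (n : nat) (A : 'I_n -> set R) :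
  (forall i, measurable (A i)) ->
  lebesgue_rV n [set v | forall i, A i (v ord0 i)] =
  (\prod_(i < n) (lebesgue_measure (A i) : \bar R))%E.
Proof.
elim: n A => [|n IH] A mA.
  rewrite big_ord0 /= diracE (_ : _ \in _ = true)//.
  by apply/mem_set => -[].
have mB : measurable [set v : 'rV[R]_n | forall i, A (lift ord0 i) (v ord0 i)].
  rewrite (_ : mkset _ = \bigcap_(i in [set: 'I_n])
    ((fun v : 'rV[R]_n => v ord0 i) @^-1` A (lift ord0 i))); last first.
    by apply/seteqP; split => v /= h i; [move=> _|]; exact: h.
  apply: fin_bigcap_measurable => // i _.
  by rewrite -[X in measurable X]setTI; exact: measurable_coord_rV.
rewrite big_ord_recl -IH//= /lebesgue_rV_cons /pushforward.
transitivity ((@lebesgue_measure R \x lebesgue_rV n)%E (A ord0 `*`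
    [set v : 'rV[R]_n | forall i, A (lift ord0 i) (v ord0 i)])); last first.
  by apply: (@product_measure1E _ _ _ _ _ (@lebesgue_measure R)
    (lebesgue_rV n)) => //; exact: mA.
congr (_ _); apply/seteqP; split => -[x v] /=.
  move=> h; split=> [|i]; first by have := h ord0; rewrite mxE unlift_none.
  by have := h (lift ord0 i); rewrite mxE liftK.
move=> [h0 h] i; rewrite mxE.
by case: unliftP => [j ->|->].
Qed.

Section function_spaces.
Context {R : realType}.
Local Open Scope ereal_scope.

Definition Lp d (T : measurableType d) (mu : {measure set T -> \bar R})
    (p : \bar R) (D : set T) : set (T -> R) :=
  [set f | f \_ D \in Lfun mu p].

Definition Lp_norm d (T : measurableType d) (mu : {measure set T -> \bar R})
    (p : \bar R) (D : set T) (f : T -> R) : \bar R :=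
  'N[mu]_p[EFin \o (f \_ D)].

Definition euclidean_norm N (v : 'rV[R]_N) : R :=
  Num.sqrt (\sum_(i < N) v ord0 i ^+ 2)%R.

Definition Lp_vec d (T : measurableType d) (mu : {measure set T -> \bar R})
    (p : \bar R) N (D : set T) : set (T -> 'rV[R]_N) :=
  [set F | measurable_fun D F /\ Lp mu p D (@euclidean_norm N \o F)].

Definition Lp_norm_vec d (T : measurableType d)
    (mu : {measure set T -> \bar R}) (p : \bar R) N (D : set T)
    (F : T -> 'rV[R]_N) : \bar R :=
  Lp_norm mu p D (@euclidean_norm N \o F).

(* Real functions on an open D that are C^1 with compact support in D,
   identified with their extensions by 0 to the whole space. *)
Definition C1c (V : normedModType R) (D : set V) : set (V -> R) :=
  [set phi | [/\ (forall x, differentiable phi x),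
                 (forall v, continuous ('D_v phi)),
                 compact (closure [set x | phi x != 0%R]) &
                 closure [set x | phi x != 0%R] `<=` D]].

End function_spaces.

Section sobolev.
Context {R : realType} {N : nat}.
Local Notation RN := 'rV[R]_N.
Local Notation leb := (@lebesgue_rV R N).
Local Notation leb2 := (leb \x leb)%E.
Implicit Types (Omega : set RN) (u : RN -> R) (i : 'I_N) (p : \bar R).

Definition L1loc Omega u : Prop :=
  measurable_fun Omega u /\
  forall K, compact K -> K `<=` Omega -> leb.-integrable K (EFin \o u).

Definition L1loc2 Omega (g : RN * RN -> R) : Prop :=
  measurable_fun (Omega `*` Omega) g /\
  forall K, compact K -> K `<=` Omega `*` Omega ->
    leb2.-integrable K (EFin \o g).

Definition basis_vec i : RN := delta_mx ord0 i.

(* The test functions are C^1_c, as for the nonlocal derivative below; for first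
   order derivatives this is the convention of Gilbarg-Trudinger (7.3) and
   Evans-Gariepy (4.1). *)
Definition is_weak_partial Omega i u (g : RN -> R) : Prop :=
  [/\ L1loc Omega u, L1loc Omega g &
      forall phi, C1c Omega phi ->
        \int[leb]_(x in Omega) (u x * 'D_(basis_vec i) phi x) =
        - \int[leb]_(x in Omega) (g x * phi x)].

Definition is_weak_gradient Omega u (G : RN -> RN) : Prop :=
  forall i, is_weak_partial Omega i u (fun x => G x ord0 i).

Definition nonlocal_adjoint Omega i (psi : RN * RN -> R) (x : RN) : R :=
  \int[leb]_(y in Omega)
    'D_(basis_vec i) (fun x' : RN => psi (y, x') - psi (x', y)) x.

Definition is_nonlocal_partial Omega i u (g : RN * RN -> R) : Prop :=
  [/\ L1loc Omega u, L1loc2 Omega g &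
      forall psi, C1c (Omega `*` Omega) psi ->
        \int[leb]_(x in Omega) (u x * nonlocal_adjoint Omega i psi x) =
        - \int[leb2]_(z in Omega `*` Omega) (g z * psi z)].

Definition is_nonlocal_gradient Omega u (G : RN * RN -> RN) : Prop :=
  forall i, is_nonlocal_partial Omega i u (fun z => G z ord0 i).

(* Weak gradients are unique up to a null set; these pick a representative,
   and are meaningful only when one exists. *)
Definition weak_gradient Omega u : RN -> RN :=
  xget (cst 0) [set G | is_weak_gradient Omega u G].

Definition nonlocal_gradient Omega u : RN * RN -> RN :=
  xget (cst 0) [set G | is_nonlocal_gradient Omega u G].

(* Elements of the spaces are represented by functions on RN, of which only the
   values on Omega matter. *)
Definition sobolev p Omega : set (RN -> R) :=
  [set u | Lp leb p Omega u /\
     exists2 G, is_weak_gradient Omega u G & Lp_vec leb p Omega G].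

Definition sobolev_norm p Omega u : \bar R :=
  (Lp_norm leb p Omega u +
   Lp_norm_vec leb p Omega (weak_gradient Omega u))%E.

Definition nonlocal_sobolev p Omega : set (RN -> R) :=
  [set u | Lp leb p Omega u /\
     exists2 G, is_nonlocal_gradient Omega u G &
       Lp_vec leb2 p (Omega `*` Omega) G].

Definition nonlocal_sobolev_norm p Omega u : \bar R :=
  (Lp_norm leb p Omega u +
   Lp_norm_vec leb2 p (Omega `*` Omega) (nonlocal_gradient Omega u))%E.

End sobolev.

Definition equivalent_norms {R : realType} (U : Type) (W : set U)
    (norm1 norm2 : U -> \bar R) : Prop :=
  exists c C : R, [/\ (0 < c)%R, (0 < C)%R &
    forall u, W u ->
      (c%:E * norm1 u <= norm2 u)%E /\ (norm2 u <= C%:E * norm1 u)%E].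

(* Main.v *)
Require Import Defs.
From mathcomp Require Import all_boot all_order all_algebra.
From mathcomp Require Import all_classical all_reals all_analysis.
From mathcomp Require Import measurable_realfun ess_sup_inf.
From mathcomp Require Import ring lra.

(** Both gradients determine each other by explicit formulas, and these formulas
    give the two norm estimates.

    If [g] is the weak partial derivative of [u] in direction [i], then the
    nonlocal one is [g y - g x]. Indeed the nonlocal adjoint of [psi] only
    involves derivatives of [psi] along one of its two variables, so Fubini's
    theorem reduces the nonlocal identity to the weak one, applied to the
    sections of [psi], which are admissible test functions on [Omega]
    ([weak_to_nonlocal]).

    Conversely, fix once and for all a test function [eta] on [Omega] with
    integral 1. Testing the nonlocal identity against [phi x * eta y] turns one
    of its two left-hand terms into the integral of [u * D_i phi], and the other
    one into a multiple of the integral of [phi]. So [u] has the weak partial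
    derivative
    [- (int u * D_i eta) - int g (x, y) * eta y dy]
    ([nonlocal_to_weak]).

    In the first formula, integrating a function of one variable over
    [Omega * Omega] costs a power of the measure of [Omega] when [p] is finite
    and nothing when [p] is infinite ([Lp_norm_difference]). In the second one,
    both terms are pairings with bounded functions of compact support, which
    Hoelder's inequality bounds by the [Lp] norm of [u], respectively of the
    sections of [g]; the first term is a constant, whose [Lp] norm is finite by
    the same assumption on [Omega] ([Lp_norm_recovered]). So the spaces
    coincide.

    The norms are defined through chosen representatives of the gradients. To
    compare them with the formulas above one needs that gradients are unique
    almost everywhere, that is the fundamental lemma of the calculus of
    variations on [Omega] and on [Omega * Omega] ([ae_eq0_test] and
    [ae_eq0_test2]). It is obtained by approximating indicators of boxes by
    [C1] functions, and by a pi-lambda argument on boxes. *)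

Set Implicit Arguments.
Unset Strict Implicit.
Unset Printing Implicit Defensive.
Import Order.TTheory GRing.Theory Num.Theory.
Import numFieldNormedType.Exports.
Local Open Scope classical_set_scope.
Local Open Scope ring_scope.

(** * Boxes, Borel sets and Lebesgue measure of row vectors *)

Lemma bigcup_measurable_countType d (T : measurableType d) (I : countType)
    (D : set I) (F : I -> set T) :
  (forall i, D i -> measurable (F i)) -> measurable (\bigcup_(i in D) F i).
Proof.
move=> mF; pose G k := if unpickle k is Some i then
  (if i \in D then F i else set0) else set0.
have -> : \bigcup_(i in D) F i = \bigcup_k G k.
  apply/seteqP; split=> [x [i Di Fx]|x [k _]].
    by exists (pickle i) => //; rewrite /G pickleK mem_set.
  by rewrite /G; case: unpickle => // i; case: ifPn => // /set_mem Di Fx; exists i.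
apply: bigcupT_measurable => k; rewrite /G; case: unpickle => // i.
by case: ifPn => // /set_mem; exact: mF.
Qed.

Section boxes.
Context {R : realType} {n : nat}.
Implicit Types (a b c d x : 'rV[R]_n) (U K : set 'rV[R]_n).

Definition box a b : set 'rV[R]_n :=
  [set x | forall i, a ord0 i < x ord0 i < b ord0 i].

Definition cbox a b : set 'rV[R]_n :=
  [set x | forall i, a ord0 i <= x ord0 i <= b ord0 i].

Definition rat_row (q : 'rV[rat]_n) : 'rV[R]_n := \row_i ratr (q ord0 i).

Lemma box_cbox a b : box a b `<=` cbox a b.
Proof. by move=> x h i; have /andP[? ?] := h i; rewrite !ltW. Qed.

Lemma boxI a b c d : box a b `&` box c d =
  box (\row_i Num.max (a ord0 i) (c ord0 i)) (\row_i Num.min (b ord0 i) (d ord0 i)).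
Proof.
apply/seteqP; split=> x.
  move=> [h k] i; rewrite !mxE gt_max lt_min.
  by have /andP[-> ->] := h i; have /andP[-> ->] := k i.
move=> h; split=> i; have := h i; rewrite !mxE gt_max lt_min;
  by move=> /andP[/andP[? ?] /andP[? ?]]; apply/andP.
Qed.

Lemma measurable_box a b : measurable (box a b).
Proof.
rewrite (_ : box a b = \bigcap_(i in [set: 'I_n])
    ((fun v : 'rV[R]_n => v ord0 i) @^-1` `]a ord0 i, b ord0 i[%classic)).
  apply: fin_bigcap_measurable => // i _.
  by rewrite -[X in measurable X]setTI; exact: measurable_coord_rV.
by apply/seteqP; split=> x h i; [move=> _|]; have := h i;
  rewrite /= ?in_itv/=; [|apply].
Qed.

Lemma cbox_compact a b : compact (cbox a b).
Proof.
rewrite (_ : cbox a b = [set v | forall i, `[a ord0 i, b ord0 i]%classic (v ord0 i)]).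
  exact: (@rV_compact _ _ (fun i => `[a ord0 i, b ord0 i]%classic)
    (fun i => @segment_compact _ _ _)).
by apply/seteqP; split=> x h i; have := h i; rewrite /= in_itv.
Qed.

(** The closed box inside [U] makes the cover of [U] by such open boxes one by
    relatively compact sets; rational corners make it countable. *)
Lemma open_rat_box U x : open U -> U x ->
  exists q : 'rV[rat]_n * 'rV[rat]_n,
    box (rat_row q.1) (rat_row q.2) x /\ cbox (rat_row q.1) (rat_row q.2) `<=` U.
Proof.
move=> oU Ux; have /nbhs_ballP[e /= e0 eU] : nbhs x U by exact: open_nbhs_nbhs.
have /choice[a ha] : forall i, exists q : rat, ratr q \in `](x ord0 i - e), (x ord0 i)[.
  by move=> i; apply: rat_in_itvoo; rewrite ltrBlDr ltrDl.
have /choice[b hb] : forall i, exists q : rat, ratr q \in `](x ord0 i), (x ord0 i + e)[.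
  by move=> i; apply: rat_in_itvoo; rewrite ltrDl.
exists (\row_i a i, \row_i b i); split => [i|y hy].
  rewrite !mxE; have := ha i; have := hb i; rewrite !in_itv/=.
  by move=> /andP[-> _] /andP[_ ->].
apply: eU; split=> // j i; rewrite ord1 /ball/=.
have := hy i; have := ha i; have := hb i; rewrite !mxE !in_itv/=.
move=> /andP[_ h1] /andP[h2 _] /andP[h3 h4].
rewrite distrC ltr_distl; apply/andP; split.
  exact: lt_le_trans h3.
exact: le_lt_trans h1.
Qed.

(** The sigma-algebra generated by the coordinates contains the Borel sets
    because every open set is a countable union of boxes. *)
Lemma open_measurable_rV U : open U -> measurable U.
Proof.
move=> oU; pose D := [set q : 'rV[rat]_n * 'rV[rat]_n |
  cbox (rat_row q.1) (rat_row q.2) `<=` U].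
rewrite (_ : U = \bigcup_(q in D) box (rat_row q.1) (rat_row q.2)).
  by apply: bigcup_measurable_countType => q _; exact: measurable_box.
apply/seteqP; split=> [x Ux|x [q Dq /box_cbox]]; last exact: Dq.
by have [q [qx qU]] := open_rat_box oU Ux; exists q.
Qed.

End boxes.

Lemma open_rat_box2 {R : realType} {m n : nat} (U : set ('rV[R]_m * 'rV[R]_n)) x :
  open U -> U x ->
  exists q : ('rV[rat]_m * 'rV[rat]_m) * ('rV[rat]_n * 'rV[rat]_n),
    (box (rat_row q.1.1) (rat_row q.1.2) `*` box (rat_row q.2.1) (rat_row q.2.2)) x /\
    cbox (rat_row q.1.1) (rat_row q.1.2) `*` cbox (rat_row q.2.1) (rat_row q.2.2)
      `<=` U.
Proof.
move=> oU Ux; have [[/= A B] [/= nA nB] ABU] : nbhs x U by exact: open_nbhs_nbhs.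
move: nA nB; rewrite !nbhsE => -[A' [oA' A'x] sA] [B' [oB' B'x] sB].
have [q [qx qA]] := open_rat_box oA' A'x; have [r [rx rB]] := open_rat_box oB' B'x.
exists (q, r); split=> // z [z1 z2]; apply: ABU; split => /=.
  exact/sA/qA.
exact/sB/rB.
Qed.

Lemma open_measurable_rV2 {R : realType} {m n : nat} (U : set ('rV[R]_m * 'rV[R]_n)) :
  open U -> measurable U.
Proof.
move=> oU; pose D := [set q : ('rV[rat]_m * 'rV[rat]_m) * ('rV[rat]_n * 'rV[rat]_n) |
  cbox (R:=R) (rat_row q.1.1) (rat_row q.1.2) `*`
  cbox (rat_row q.2.1) (rat_row q.2.2) `<=` U].
rewrite (_ : U = \bigcup_(q in D)
    (box (rat_row q.1.1) (rat_row q.1.2) `*` box (rat_row q.2.1) (rat_row q.2.2))).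
  by apply: bigcup_measurable_countType => q _; apply: measurableX;
    exact: measurable_box.
apply/seteqP; split=> [x Ux|x [q Dq [/box_cbox h1 /box_cbox h2]]]; last exact: Dq.
by have [q [qx qU]] := open_rat_box2 oU Ux; exists q.
Qed.

Lemma measurable_fun_gt {R : realType} d (T : measurableType d) (f : T -> R) :
  (forall c, measurable (f @^-1` `]c, +oo[)) -> measurable_fun [set: T] f.
Proof.
move=> mf; apply: (measurability _ (RGenOInfty.measurableE R)) => //.
by move=> /= _ [_ [c ->] <-]; rewrite setTI.
Qed.

Lemma continuous_measurable_rV {R : realType} n (f : 'rV[R]_n -> R) :
  continuous f -> measurable_fun [set: 'rV[R]_n] f.
Proof.
move=> /continuousP cf; apply: measurable_fun_gt => c.
have oc : open (`]c, +oo[%classic : set R).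
  by rewrite set_itvE; exact: open_gt.
exact: open_measurable_rV (cf _ oc).
Qed.

Lemma continuous_measurable_rV2 {R : realType} m n (f : 'rV[R]_m * 'rV[R]_n -> R) :
  continuous f -> measurable_fun [set: 'rV[R]_m * 'rV[R]_n] f.
Proof.
move=> /continuousP cf; apply: measurable_fun_gt => c.
have oc : open (`]c, +oo[%classic : set R).
  by rewrite set_itvE; exact: open_gt.
exact: open_measurable_rV2 (cf _ oc).
Qed.

Lemma compact_measurable_rV {R : realType} n (K : set 'rV[R]_n) :
  compact K -> measurable K.
Proof.
move=> /(compact_closed (@norm_hausdorff _ _)) cK.
rewrite -[K]setCK; apply: measurableC; apply: open_measurable_rV.
exact: closed_openC.
Qed.

Lemma compact_measurable_rV2 {R : realType} m n (K : set ('rV[R]_m * 'rV[R]_n)) :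
  compact K -> measurable K.
Proof.
move=> /(compact_closed (@norm_hausdorff _ _)) cK.
rewrite -[K]setCK; apply: measurableC; apply: open_measurable_rV2.
exact: closed_openC.
Qed.

Lemma compact_sub_cbox {R : realType} n (K : set 'rV[R]_n) :
  compact K -> exists M : R, K `<=` cbox (const_mx (- M)) (const_mx M).
Proof.
move=> /compact_bounded[M [Mr hM]]; exists (M + 1) => x Kx i; rewrite !mxE.
rewrite -ler_norml; apply: le_trans (hM (M + 1) _ _ Kx); last by rewrite ltrDl.
rewrite [leRHS]/Num.norm /= mx_normrE; apply/bigmax_geP; right => /=.
by exists (ord0, i).
Qed.

Lemma lebesgue_cboxE {R : realType} n (a b : 'rV[R]_n) :
  lebesgue_rV n (cbox a b) =
  (\prod_(i < n) (lebesgue_measure `[a ord0 i, b ord0 i] : \bar R))%E.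
Proof.
by rewrite -lebesgue_rV_box.
Qed.

Lemma lebesgue_boxE {R : realType} n (a b : 'rV[R]_n) :
  lebesgue_rV n (box a b) =
  (\prod_(i < n) (lebesgue_measure `]a ord0 i, b ord0 i[ : \bar R))%E.
Proof.
by rewrite -lebesgue_rV_box.
Qed.

Lemma lebesgue_compact_lty {R : realType} n (K : set 'rV[R]_n) :
  compact K -> (lebesgue_rV n K < +oo)%E.
Proof.
move=> cK; have [M KM] := compact_sub_cbox cK.
apply: (@le_lt_trans _ _ (lebesgue_rV n (cbox (const_mx (- M)) (const_mx M)))).
  apply: le_measure; rewrite ?inE//; first exact: compact_measurable_rV.
  by apply: compact_measurable_rV; exact: cbox_compact.
rewrite lebesgue_cboxE -ge0_fin_numE; last by apply: prode_ge0 => i _.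
elim/big_ind : _ => //; first exact: fin_numM.
by move=> i _; rewrite lebesgue_measure_itv/=; case: ifP.
Qed.

Lemma lebesgue_box_gt0 {R : realType} n (a b : 'rV[R]_n) :
  (forall i, a ord0 i < b ord0 i) -> (0 < lebesgue_rV n (box a b))%E.
Proof.
move=> ab; rewrite lebesgue_boxE; elim/big_ind : _ => //; first exact: mule_gt0.
by move=> i _; rewrite lebesgue_measure_itv/= lte_fin ab -EFinB lte_fin subr_gt0.
Qed.

Lemma compact_proj {R : realType} m n (K : set ('rV[R]_m * 'rV[R]_n)) :
  compact K -> [/\ compact (fst @` K), compact (snd @` K) &
    K `<=` (fst @` K) `*` (snd @` K)].
Proof.
move=> cK; split.
- apply: continuous_compact => //; apply: continuous_subspaceT => z.
  exact: cvg_fst.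
- apply: continuous_compact => //; apply: continuous_subspaceT => z.
  exact: cvg_snd.
- by move=> z Kz; split; exists z.
Qed.

(** * Functions of class C1 *)

Section C1.
Context {R : realType}.

(** Real functions of class C1: [C1c] without its support condition, in the form
    in which it is stable under products and composition. *)
Definition C1 (V : normedModType R) (f : V -> R) : Prop :=
  (forall x, differentiable f x) /\ (forall v, continuous ('D_v f)).

Lemma C1_continuous (V : normedModType R) (f : V -> R) : C1 f -> continuous f.
Proof. by move=> [df _] x; exact: differentiable_continuous. Qed.

Lemma C1_cst (V : normedModType R) (c : R) : C1 (fun _ : V => c).
Proof.
split=> [x|v]; first exact: differentiable_cst.
rewrite (_ : 'D_v _ = cst 0); first exact: cst_continuous.
by apply/funext => x; rewrite derive_cst.
Qed.

Lemma C1M (V : normedModType R) (f g : V -> R) :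
  C1 f -> C1 g -> C1 (fun x => f x * g x).
Proof.
move=> [df cf] [dg cg]; split=> [x|v]; first exact: differentiableM.
rewrite (_ : 'D_v _ = (f \* 'D_v g) + (g \* 'D_v f)).
  move=> x; apply: (continuousD
      (continuousM (differentiable_continuous (df x)) (cg v x))
      (continuousM (differentiable_continuous (dg x)) (cf v x))).
by apply/funext => x; rewrite -[LHS]/('D_v (f * g) x) deriveM//; exact: diff_derivable.
Qed.

Lemma C1_prod (V : normedModType R) (I : Type) (r : seq I) (f : I -> V -> R) :
  (forall i, C1 (f i)) -> C1 (fun x => \prod_(i <- r) f i x).
Proof.
move=> cf; elim: r => [|i r IH].
  by under eq_fun do rewrite big_nil; exact: C1_cst.
by under eq_fun do rewrite big_cons; exact: C1M.
Qed.

Lemma C1_comp (V : normedModType R) (q dq : R -> R) (f : V -> R) :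
  (forall t : R, is_derive t (1 : R) q (dq t)) -> continuous dq ->
  C1 f -> C1 (fun x => q (f x)).
Proof.
move=> hq cdq [df cf].
have dq' (t : R) : differentiable q t by apply/derivable1_diffP; have [] := hq t.
split=> [x|v]; first exact: differentiable_comp.
rewrite (_ : 'D_v _ = 'D_v f \* (dq \o f)).
  move=> x; apply: (continuousM (cf v x)).
  apply: continuous_comp; last exact: cdq.
  exact/differentiable_continuous/df.
apply/funext => x; rewrite deriveE; last exact: differentiable_comp.
rewrite -[LHS]/('d (q \o f) x v) diff_comp//= diff1E// derive1E.
by rewrite (deriveE _ (df x)) (@derive_val _ _ _ _ _ _ _ (hq (f x))).
Qed.

Lemma C1_coord n (i : 'I_n) : C1 (fun x : 'rV[R]_n => x ord0 i).
Proof.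
split=> [x|v]; first exact: differentiable_coord.
rewrite (_ : 'D_v _ = cst (v ord0 i)); first exact: cst_continuous.
apply/funext => x; apply: cvg_lim => //; apply: cvg_near_cst.
near=> h; rewrite /= !mxE addrK scalerA mulVf ?scale1r//.
by near: h; exact: nbhs_dnbhs_neq.
Unshelve. all: by end_near. Qed.

(** The simplest C1 function that vanishes on a half-line only; the cutoff
    functions are built from it. *)
Definition sqpos (t : R) : R := Num.max 0 t ^+ 2.

(** The derivative of [sqpos] is 2-Lipschitz, hence this remainder; it gives
    differentiability without distinguishing the sign of [t]. *)
Lemma sqpos_taylor (t h : R) :
  `|sqpos (h + t) - sqpos t - 2 * Num.max 0 t * h| <= h ^+ 2.
Proof.
rewrite /sqpos ler_norml; apply/andP; split;
  case: (lerP 0 t) => ?; case: (lerP 0 (h + t)) => ?; nra.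
Qed.

Lemma is_derive_sqpos (t : R) : is_derive t (1 : R) sqpos (2 * Num.max 0 t).
Proof.
suff H : (fun h : R => h^-1 *: ((sqpos \o shift t) (h *: (1:R)) - sqpos t)) @ 0^'
    --> (2 * Num.max 0 t : R).
  split; [by apply/cvg_ex; exists (2 * Num.max 0 t)|exact: cvg_lim].
apply/cvgrPdist_le => /= e e0; near=> h.
have h0 : h != 0 by near: h; exact: nbhs_dnbhs_neq.
have he : `|h| <= e by near: h; apply: dnbhs0_le.
apply: le_trans he; rewrite -(ler_pM2l (_ : 0 < `|h|)) ?normr_gt0//.
rewrite -normrM -[leRHS]normrM -expr2 [leRHS]ger0_norm ?sqr_ge0//.
apply: le_trans (sqpos_taylor t h); rewrite -normrN -[h%:A]/(h * 1) mulr1.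
rewrite -[_ *: _]/(_ * _) mulrBr mulVKf//=.
by rewrite le_eqVlt; apply/orP; left; apply/eqP; congr (`| _ |); ring.
Unshelve. all: by end_near. Qed.

Lemma C1_sqpos (V : normedModType R) (f : V -> R) : C1 f -> C1 (fun x => sqpos (f x)).
Proof.
apply: (C1_comp is_derive_sqpos) => t.
have mc : {for t, continuous (fun x : R => Num.max 0 x)}.
  by apply: (@continuous_max _ _ (cst 0) id); [exact: cst_continuous|exact: cvg_id].
exact: (cvgM (cvg_cst (2 : R)) mc).
Qed.

Lemma C1_affine (V : normedModType R) (f : V -> R) (a b : R) :
  C1 f -> C1 (fun x => a + b * f x).
Proof.
apply: (C1_comp (q := fun t => a + b * t) (dq := cst b)).
  move=> t; apply: is_derive_eq; rewrite add0r /=.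
  by rewrite mul1r -[LHS]/(b * 1) mulr1.
exact: cst_continuous.
Qed.

(** A C1 step: 0 for nonpositive arguments, 1 from 1 on. Indeed
    [1 - sqpos t] is 1 for nonpositive [t], and nonpositive from 1 on, where the
    outer [sqpos] flattens it. *)
Definition step (t : R) : R := 1 - sqpos (1 - sqpos t).

Lemma step_le0 t : t <= 0 -> step t = 0.
Proof.
move=> t0; have -> : step t = 1 - sqpos 1.
  by rewrite /step [sqpos t]/sqpos max_l// expr0n/= subr0.
by rewrite /sqpos max_r// expr1n subrr.
Qed.

Lemma step_ge1 t : 1 <= t -> step t = 1.
Proof.
move=> t1; have t0 : 0 <= t := le_trans ler01 t1.
rewrite /step {1}/sqpos max_l ?expr0n ?subr0// subr_le0 /sqpos max_r//.
exact: exprn_ege1.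
Qed.

Lemma step_ge0 t : 0 <= step t.
Proof.
rewrite /step {1}/sqpos subr_ge0.
have m0 : 0 <= Num.max 0 (1 - sqpos t) by rewrite le_max lexx.
by rewrite expr_le1// ge_max ler01/= gerBl sqr_ge0.
Qed.

Lemma step_le1 t : step t <= 1.
Proof. by rewrite /step gerBl sqr_ge0. Qed.

Lemma C1_step (V : normedModType R) (f : V -> R) : C1 f -> C1 (fun x => step (f x)).
Proof.
move=> cf; rewrite /step.
have H (g : V -> R) : C1 g -> C1 (fun x => 1 - g x).
  by move=> /(C1_affine 1 (-1)); under eq_fun do rewrite mulN1r.
exact/(H _)/C1_sqpos/(H _)/C1_sqpos.
Qed.

End C1.

(** * Test functions *)

Section test_functions.
Context {R : realType}.

(** Test functions and their directional derivatives all have this property, which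
    is what integrability arguments use. *)
Definition Cc (V : normedModType R) (D : set V) (f : V -> R) : Prop :=
  continuous f /\
  exists K, [/\ compact K, K `<=` D & forall x, ~ K x -> f x = 0].

Lemma Cc_bounded (V : normedModType R) (D : set V) (f : V -> R) :
  Cc D f -> exists2 M, 0 <= M & forall x, `|f x| <= M.
Proof.
move=> [cf [K [cK KD f0]]].
have /compact_bounded[M [Mr hM]] : compact (f @` K).
  by apply: continuous_compact => //; exact: continuous_subspaceT.
exists (`|M| + 1) => [|x]; first by rewrite addr_ge0.
have [Kx|nK] := pselect (K x); last by rewrite f0// normr0 addr_ge0.
by apply: hM; [rewrite (le_lt_trans (ler_norm M))// ltrDl|exists x].
Qed.

Lemma C1cP (V : normedModType R) (D : set V) (f : V -> R) :
  C1c D f <-> C1 f /\ Cc D f.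
Proof.
split=> [[df cdf cK KD]|[[df cdf] [_ [K [cK KD f0]]]]].
  split=> //; split; first exact: C1_continuous.
  exists (closure [set x | f x != 0]); split=> // x nx.
  by apply: contrapT => /eqP fx; apply: nx; exact: subset_closure.
have sK : closure [set x | f x != 0] `<=` K.
  rewrite -[X in _ `<=` X](_ : closure K = _); last first.
    by apply/esym/closure_id/(compact_closed _ cK)/norm_hausdorff.
  by apply: closure_subset => x /= /eqP fx; apply: contrapT => /f0.
split=> //; last exact: subset_trans KD.
by apply: subclosed_compact cK sK; exact: closed_closure.
Qed.

(** Outside the support of [f] the difference quotients vanish near 0. *)
Lemma C1c_derive (V : normedModType R) (D : set V) (f : V -> R) v :
  C1c D f -> Cc D ('D_v f).
Proof.
move=> [df cdf cK KD]; split=> //.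
exists (closure [set x | f x != 0]); split=> // x nx.
have : nbhs x (~` closure [set x | f x != 0]).
  by apply: open_nbhs_nbhs; split=> //; apply: closed_openC; exact: closed_closure.
move=> nx0; apply: cvg_lim => //; apply: cvg_near_cst.
have f0 y : (~` closure [set x | f x != 0]) y -> f y = 0.
  by move=> ny; apply: contrapT => /eqP fy; apply: ny; exact: subset_closure.
have H : \forall h \near 0^', (~` closure [set x | f x != 0]) (h *: v + x).
  have : (fun h : R => h *: v + x) @ 0^' --> x.
    rewrite -[X in _ --> X](_ : 0 *: v + x = x); last by rewrite scale0r add0r.
    apply: cvgD; last exact: cvg_cst.
    apply: cvgZr_tmp.
    by apply: cvg_within_filter; exact: cvg_id.
  by move=> /(_ _ nx0).
near=> h; rewrite /= (f0 (h *: v + x)); last by near: h.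
by rewrite f0 ?subrr ?scaler0//; exact: nbhs_singleton nx0.
Unshelve. all: by end_near. Qed.

(** Test functions that converge to the indicator of the open box between [a] and
    [b]: each factor is a step that becomes steeper with [k]. *)
Definition cutoff n (a b : 'rV[R]_n) (k : nat) (x : 'rV[R]_n) : R :=
  \prod_(i < n) (step (k.+1%:R * (x ord0 i - a ord0 i)) *
                 step (k.+1%:R * (b ord0 i - x ord0 i))).

Lemma cutoff_ge0 n (a b : 'rV[R]_n) k x : 0 <= cutoff a b k x.
Proof. by apply: prodr_ge0 => i _; rewrite mulr_ge0 ?step_ge0. Qed.

Lemma cutoff_le1 n (a b : 'rV[R]_n) k x : cutoff a b k x <= 1.
Proof.
apply: Num.Theory.prodr_ile1 => i _.
by rewrite mulr_ge0 ?mulr_ile1 ?step_ge0 ?step_le1.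
Qed.

Lemma cutoff_notin n (a b : 'rV[R]_n) k x : ~ box a b x -> cutoff a b k x = 0.
Proof.
move=> /existsNP[i /negP]; rewrite negb_and -!leNgt => h.
apply/eqP; rewrite /cutoff (bigD1 i)//= !mulf_eq0.
by case/orP: h => h; apply/orP; left; apply/orP; [left|right];
  rewrite step_le0// pmulr_rle0// subr_le0.
Qed.

Lemma cutoff_in n (a b : 'rV[R]_n) x : box a b x ->
  \forall k \near \oo, cutoff a b k x = 1.
Proof.
move=> h.
have H (c : R) : 0 < c -> \forall k \near \oo, step (k.+1%:R * c) = 1.
  move=> c0; have ci0 : 0 < c^-1 by rewrite invr_gt0.
  near=> k; apply: step_ge1.
  rewrite -ler_pdivrMr// div1r (@le_trans _ _ k%:R) ?ler_nat//.
  by near: k; exact: nbhs_infty_ger.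
have : \forall k \near \oo, forall i : 'I_n,
    step (k.+1%:R * (x ord0 i - a ord0 i)) = 1 /\
    step (k.+1%:R * (b ord0 i - x ord0 i)) = 1.
  apply: filter_forall => i; have /andP[h1 h2] := h i.
  by near=> k; split; near: k; apply: H; rewrite subr_gt0.
apply: filterS => k hk; rewrite /cutoff big1// => i _.
by have [-> ->] := hk i; rewrite mulr1.
Unshelve. all: by end_near. Qed.

Lemma cutoff_C1c n (a b : 'rV[R]_n) (D : set 'rV[R]_n) k :
  cbox a b `<=` D -> C1c D (cutoff a b k).
Proof.
move=> abD; apply/C1cP; have c1 : C1 (cutoff a b k).
  apply: C1_prod => i; apply: C1M; apply: C1_step.
    rewrite (_ : (fun _ => _) = fun x : 'rV[R]_n =>
        - (k.+1%:R * a ord0 i) + k.+1%:R * x ord0 i).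
      by apply: C1_affine; exact: C1_coord.
    by apply/funext => x; rewrite mulrBr addrC.
  rewrite (_ : (fun _ => _) = fun x : 'rV[R]_n =>
      k.+1%:R * b ord0 i + (- k.+1%:R) * x ord0 i).
    by apply: C1_affine; exact: C1_coord.
  by apply/funext => x; rewrite mulrBr mulNr.
split=> //; split; first exact: C1_continuous.
exists (cbox a b); split=> //; first exact: cbox_compact.
by move=> x nx; apply: cutoff_notin => /box_cbox.
Qed.

Lemma C1_fst (V W : normedModType R) (f : V -> R) :
  C1 f -> C1 (fun z : V * W => f z.1).
Proof.
move=> [df cdf]; split=> [z|v].
  apply: (@differentiable_comp _ _ _ _ fst f); last exact: df.
  have fc : continuous (fst : V * W -> V) by move=> ?; exact: cvg_fst.
  exact: linear_differentiable.
rewrite (_ : 'D_v _ = 'D_(v.1) f \o fst); last exact/funext.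
by move=> z; apply: continuous_comp; [exact: cvg_fst|exact: cdf].
Qed.

Lemma C1_snd (V W : normedModType R) (f : W -> R) :
  C1 f -> C1 (fun z : V * W => f z.2).
Proof.
move=> [df cdf]; split=> [z|v].
  apply: (@differentiable_comp _ _ _ _ snd f); last exact: df.
  have fc : continuous (snd : V * W -> W) by move=> ?; exact: cvg_snd.
  exact: linear_differentiable.
rewrite (_ : 'D_v _ = 'D_(v.2) f \o snd); last exact/funext.
by move=> z; apply: continuous_comp; [exact: cvg_snd|exact: cdf].
Qed.

Lemma C1c_tensor (V W : normedModType R) (D : set V) (E : set W) f g :
  C1c D f -> C1c E g -> C1c (D `*` E) (fun z => f z.1 * g z.2).
Proof.
move=> /C1cP[c1f [_ [K [cK KD f0]]]] /C1cP[c1g [_ [L [cL LE g0]]]].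
apply/C1cP; have c1 : C1 (fun z : V * W => f z.1 * g z.2).
  by apply: C1M; [exact: C1_fst|exact: C1_snd].
split=> //; split; first exact: C1_continuous.
exists (K `*` L); split; [exact: compact_setX|by move=> z [/KD ? /LE ?]|].
move=> [x y] /= /not_andP[/f0->|/g0->]; by rewrite ?mul0r ?mulr0.
Qed.

(** Both sides are limits of the same difference quotients. *)
Lemma derive_section1 (V W : normedModType R) (f : V * W -> R) (y : W) v x :
  'D_v (fun x' => f (x', y)) x = 'D_(v, 0) f (x, y).
Proof.
rewrite /derive; set q := (X in lim (X @ _)); set r := (X in _ = lim (X @ _)).
rewrite (_ : q = r)//; apply/funext => h; rewrite /q /r /=.
by congr (_ *: (f _ - _)); congr pair; rewrite /= scaler0 add0r.
Qed.

Lemma derive_section2 (V W : normedModType R) (f : V * W -> R) (x : V) v y :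
  'D_v (fun y' => f (x, y')) y = 'D_(0, v) f (x, y).
Proof.
rewrite /derive; set q := (X in lim (X @ _)); set r := (X in _ = lim (X @ _)).
rewrite (_ : q = r)//; apply/funext => h; rewrite /q /r /=.
by congr (_ *: (f _ - _)); congr pair; rewrite /= scaler0 add0r.
Qed.

Lemma Cc_section1 (V W : normedModType R) (D : set V) (E : set W) f y :
  Cc (D `*` E) f -> Cc D (fun x => f (x, y)).
Proof.
move=> [cf [K [cK KDE f0]]]; split.
  move=> x; apply: (continuous_comp (f := fun x => (x, y))); last exact: cf.
  by apply: cvg_pair; [exact: cvg_id|exact: cvg_cst].
exists (fst @` K); split.
- by apply: continuous_compact => //; apply: continuous_subspaceT => z; exact: cvg_fst.
- by move=> _ [z /KDE[? ?] <-].
- by move=> x nx; apply: f0 => Kxy; apply: nx; exists (x, y).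
Qed.

Lemma Cc_section2 (V W : normedModType R) (D : set V) (E : set W) f x :
  Cc (D `*` E) f -> Cc E (fun y => f (x, y)).
Proof.
move=> [cf [K [cK KDE f0]]]; split.
  move=> y; apply: (continuous_comp (f := fun y => (x, y))); last exact: cf.
  by apply: cvg_pair; [exact: cvg_cst|exact: cvg_id].
exists (snd @` K); split.
- by apply: continuous_compact => //; apply: continuous_subspaceT => z; exact: cvg_snd.
- by move=> _ [z /KDE[? ?] <-].
- by move=> y ny; apply: f0 => Kxy; apply: ny; exists (x, y).
Qed.

Lemma C1c_section1 (V W : normedModType R) (D : set V) (E : set W) f y :
  C1c (D `*` E) f -> C1c D (fun x => f (x, y)).
Proof.
move=> /C1cP[[df cdf] ccf]; apply/C1cP; split; last exact: Cc_section1 ccf.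
split=> [x|v].
  apply: (@differentiable_comp _ _ _ _ (fun x => (x, y)) f); last exact: df.
  apply: differentiable_pair; last exact: differentiable_cst.
  by have [] := is_diff_id x.
rewrite (_ : 'D_v _ = fun x => 'D_(v, 0) f (x, y)); last first.
  by apply/funext => x; exact: derive_section1.
move=> x; apply: (continuous_comp (f := fun x => (x, y)) (g := 'D_(v, 0) f));
  last exact: cdf.
by apply: cvg_pair; [exact: cvg_id|exact: cvg_cst].
Qed.

Lemma C1c_section2 (V W : normedModType R) (D : set V) (E : set W) f x :
  C1c (D `*` E) f -> C1c E (fun y => f (x, y)).
Proof.
move=> /C1cP[[df cdf] ccf]; apply/C1cP; split; last exact: Cc_section2 ccf.
split=> [y|v].
  apply: (@differentiable_comp _ _ _ _ (fun y => (x, y)) f); last exact: df.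
  apply: differentiable_pair; first exact: differentiable_cst.
  by have [] := is_diff_id y.
rewrite (_ : 'D_v _ = fun y => 'D_(0, v) f (x, y)); last first.
  by apply/funext => y; exact: derive_section2.
move=> y; apply: (continuous_comp (f := fun y => (x, y)) (g := 'D_(0, v) f));
  last exact: cdf.
by apply: cvg_pair; [exact: cvg_cst|exact: cvg_id].
Qed.

End test_functions.

(** * Boxes as a pi-system, and vanishing of functions with null integrals *)

Section vanishing.
Context {R : realType} d (T : measurableType d) (mu : {measure set T -> \bar R}).
Local Open Scope ereal_scope.

(** The sets on which the integral of [f] vanishes form a lambda-system, so that
    all measurable subsets of [Q] have this property, and [f] vanishes almost
    everywhere on [Q]. *)
Lemma ae_eq0_pi_system (G : set_system T) (Q : set T) (f : T -> \bar R) :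
  @measurable _ T = <<s G >> -> setI_closed G -> measurable Q ->
  mu.-integrable Q f -> \int[mu]_(x in Q) f x = 0 ->
  (forall A, G A -> \int[mu]_(x in A `&` Q) f x = 0) ->
  {ae mu, forall x, Q x -> f x = 0}.
Proof.
move=> mG GI mQ fi fQ fG.
have iS S : measurable S -> mu.-integrable (S `&` Q) f.
  by move=> mS; apply: integrableS fi => //; exact: measurableI.
have mS S : measurable S -> measurable_fun (S `&` Q) f.
  by move=> /iS/measurable_int.
have H S : measurable S -> \int[mu]_(x in S `&` Q) f x = 0.
  rewrite mG; apply: (dynkin_induction (P := fun S => \int[mu]_(x in S `&` Q) f x = 0)
    mG GI) => [||S0 mS0 h|F mF tF h] //.
  - by rewrite setTI.
  - move: fQ; rewrite -{1}(setTI Q) -(setvU S0) setIUl integral_setU.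
    + by rewrite h adde0.
    + exact/measurableI/mQ/measurableC.
    + exact: measurableI.
    + by rewrite -setIUl; apply: mS; rewrite setvU.
    + by apply/disj_setPS => x [[nS _] [Sx _]].
  - rewrite setI_bigcupl integral_bigcup.
    + by rewrite eseries0// => k _ _; exact: h.
    + by apply: trivIset_setIr.
    + by move=> k; exact: measurableI.
    + by rewrite -setI_bigcupl; apply: iS; exact: bigcupT_measurable.
have := @integral_ae_eq _ _ _ mu _ mQ (cst 0) f fi (measurable_cst _) _.
apply => E EQ mE; rewrite integral0.
by rewrite -(H _ mE) (setIidl EQ).
Qed.

(** Dominated convergence: the functions [f * chi k] are dominated by [f], and
    converge to [f] on [A] and to 0 elsewhere. *)
Lemma integral_eq0_limit (D A : set T) (f : T -> R) (chi : nat -> T -> R) :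
  measurable D -> measurable A -> A `<=` D ->
  mu.-integrable A (EFin \o f) ->
  (forall k, measurable_fun [set: T] (chi k)) ->
  (forall k x, (0 <= chi k x <= 1)%R) ->
  (forall k x, ~ A x -> chi k x = 0%R) ->
  (forall x, A x -> \forall k \near \oo, chi k x = 1%R) ->
  (forall k, (\int[mu]_(x in D) (f x * chi k x))%R = 0%R) ->
  \int[mu]_(x in A) (f x)%:E = 0.
Proof.
move=> mD mA AD fi mchi chi01 chi0 chi1 fchi.
have mf := measurable_int mu fi.
have mfchi k : measurable_fun A (fun x => (f x * chi k x)%:E).
  apply/measurable_EFinP/measurable_funM; first exact/measurable_EFinP.
  exact: measurable_funTS.
have fchi_le k x : `|(f x * chi k x)%:E| <= `|(f x)%:E|.
  rewrite !abse_EFin lee_fin normrM ler_piMr//.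
  by have /andP[h0 h1] := chi01 k x; rewrite ger0_norm.
have fk k : \int[mu]_(x in A) (f x * chi k x)%:E = 0.
  have ik : mu.-integrable A (fun x => (f x * chi k x)%:E).
    by apply: le_integrable fi.
  rewrite -(fineK (integrable_fin_num _ ik))//; congr EFin.
  rewrite -[RHS](fchi k) /Rintegral; congr fine.
  rewrite -(setIidr AD) integral_mkcondr; apply: eq_integral => x _.
  rewrite patchE; case: ifPn => // /negP; rewrite inE => nA.
  by rewrite chi0// mulr0.
have [] := @dominated_convergence _ _ _ mu A mA (fun k x => (f x * chi k x)%:E)
  (fun x => (f x)%:E) (fun x => `|(f x)%:E|) mfchi mf.
- apply: nearW => x Ax; apply: cvg_near_cst.
  by have := chi1 _ Ax; apply: filterS => k ->; rewrite mulr1.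
- exact: integrable_abse.
- by apply: nearW => x k _; exact: fchi_le.
move=> _ _; under eq_fun do rewrite fk.
by move=> h; apply/esym; exact: (cvg_unique (@ereal_hausdorff R) (cvg_cst 0) h).
Qed.

Lemma ae_forall_countType (I : countType) (D : set I) (P : I -> T -> Prop) :
  (forall i, D i -> {ae mu, forall x, P i x}) ->
  {ae mu, forall x i, D i -> P i x}.
Proof.
move=> h.
have : {ae mu, forall x k, if unpickle k is Some i then D i -> P i x else True}.
  apply: ae_foralln => k; case: unpickle => [i|]; last exact: nearW.
  have [Di|nDi] := pselect (D i); last exact: nearW.
  by apply: filterS (h i Di) => x Px _.
by apply: filterS => x hx i; have := hx (pickle i); rewrite pickleK.
Qed.

End vanishing.

Section box_generation.
Context {R : realType}.
Implicit Types (n : nat).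

(** Boxes with no order condition on the corners, so that the empty set belongs to
    the family (in positive dimension) and the family is stable under
    intersection. *)
Definition boxes n : set_system 'rV[R]_n := [set A | exists a b, A = box a b].

Definition boxes2 m n : set_system ('rV[R]_m * 'rV[R]_n) :=
  [set A | exists a b c d, A = box a b `*` box c d].

Lemma box_exhaust n (x : 'rV[R]_n) :
  exists k : nat, box (const_mx (- k%:R)) (const_mx k%:R) x.
Proof.
have [M hM] := compact_sub_cbox (@compact_set1 _ x).
exists (Num.bound `|M|) => i; have := hM x erefl i; rewrite !mxE.
have Mb : M < (Num.bound `|M|)%:R.
  by rewrite (le_lt_trans (ler_norm _))// archi_boundP.
move=> /andP[h1 h2]; rewrite (le_lt_trans h2 Mb) andbT.
by rewrite (lt_le_trans _ h1)// ltrN2.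
Qed.

(** Boxes that exhaust the half-space where coordinate [i] exceeds [c]. *)
Definition ray n (i : 'I_n) (c : R) (k : nat) : set 'rV[R]_n :=
  box (\row_j if j == i then c else - k%:R) (const_mx k%:R).

Lemma rayE n (i : 'I_n) (c : R) :
  [set x : 'rV[R]_n | c < x ord0 i] = \bigcup_k ray i c k.
Proof.
apply/seteqP; split=> [x /= cx|x [k _ /(_ i)]]; last by rewrite mxE eqxx => /andP[].
have [k kx] := box_exhaust x; exists k => // j; have := kx j; rewrite !mxE.
by case: eqP => // -> /andP[_ ->]; rewrite cx.
Qed.

Lemma setT_boxE n : [set: 'rV[R]_n] =
  \bigcup_k box (const_mx (- k%:R)) (const_mx k%:R).
Proof.
by apply/esym; rewrite -subTset => x _; have [k kx] := box_exhaust x; exists k.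
Qed.

Lemma measurable_boxesE n : @measurable _ 'rV[R]_n = <<s @boxes n >>.
Proof.
apply/seteqP; split; last first.
  apply: smallest_sub; first exact: sigma_algebra_measurable.
  by move=> _ [a [b ->]]; exact: measurable_box.
apply: smallest_sub; first exact: smallest_sigma_algebra.
move=> A; rewrite -bigcup_seq/= => -[i _ [Y mY <-]].
suff : measurable_fun setT (fun v : g_sigma_algebraType (@boxes n) =>
    (v : 'rV[R]_n) ord0 i) by exact.
apply: measurable_fun_gt => c.
rewrite (_ : _ @^-1` _ = [set x : 'rV[R]_n | c < x ord0 i]); last first.
  by apply/seteqP; split=> x /=; rewrite in_itv/= andbT.
rewrite rayE; apply: bigcupT_measurable => k; apply: sub_sigma_algebra.
by do 2 eexists.
Qed.

Lemma measurable_boxes2E m n :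
  @measurable _ ('rV[R]_m * 'rV[R]_n)%type = <<s @boxes2 m n >>.
Proof.
apply/seteqP; split; last first.
  apply: smallest_sub; first exact: sigma_algebra_measurable.
  by move=> _ [a [b [c [e ->]]]]; apply: measurableX; exact: measurable_box.
rewrite measurable_prod_measurableType.
apply: smallest_sub; first exact: smallest_sigma_algebra.
move=> _ [A mA [B mB <-]].
pose TT := g_sigma_algebraType (@boxes2 m n).
have m1 : measurable_fun setT (fun z : TT => (z : 'rV[R]_m * 'rV[R]_n).1).
  apply: measurable_fun_rV => i; apply: measurable_fun_gt => c.
  rewrite (_ : _ @^-1` _ = [set x : 'rV[R]_m | c < x ord0 i] `*` [set: 'rV[R]_n]);
    last by apply/seteqP; split=> x /=; rewrite in_itv/= andbT//; case.
  rewrite rayE setX_bigcupl; apply: bigcupT_measurable => k.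
  rewrite setT_boxE setX_bigcupr; apply: bigcupT_measurable => l.
  by apply: sub_sigma_algebra; do 4 eexists.
have m2 : measurable_fun setT (fun z : TT => (z : 'rV[R]_m * 'rV[R]_n).2).
  apply: measurable_fun_rV => i; apply: measurable_fun_gt => c.
  rewrite (_ : _ @^-1` _ = [set: 'rV[R]_m] `*` [set x : 'rV[R]_n | c < x ord0 i]);
    last by apply/seteqP; split=> x /=; rewrite in_itv/= andbT//; case.
  rewrite rayE setX_bigcupr; apply: bigcupT_measurable => k.
  rewrite setT_boxE setX_bigcupl; apply: bigcupT_measurable => l.
  by apply: sub_sigma_algebra; do 4 eexists.
rewrite (_ : A `*` B = (fun z : TT => (z : 'rV[R]_m * 'rV[R]_n).1) @^-1` A `&`
   (fun z : TT => (z : 'rV[R]_m * 'rV[R]_n).2) @^-1` B)//.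
have := m1 measurableT _ mA; have := m2 measurableT _ mB; rewrite !setTI => h2 h1.
exact: (measurableI _ _ h1 h2).
Qed.

Lemma boxes_setI n : setI_closed (@boxes n).
Proof. by move=> _ _ [a [b ->]] [c [e ->]]; rewrite boxI; do 2 eexists. Qed.

Lemma boxes2_setI m n : setI_closed (@boxes2 m n).
Proof.
move=> _ _ [a [b [a' [b' ->]]]] [c [e [c' [e' ->]]]].
by rewrite -setXI !boxI; do 4 eexists.
Qed.

End box_generation.

(** * The fundamental lemma of the calculus of variations *)

Lemma cboxI_sub {R : realType} n (a b c d : 'rV[R]_n) :
  cbox (\row_i Num.max (a ord0 i) (c ord0 i)) (\row_i Num.min (b ord0 i) (d ord0 i))
  `<=` cbox c d.
Proof.
move=> x h i; have := h i; rewrite !mxE ge_max le_min.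
by move=> /andP[/andP[_ ->] /andP[_ ->]].
Qed.

Section fundamental_lemma.
Context {R : realType}.

(** Over an open box whose closed box lies in [D], the integral of [f] is the limit
    of its integrals against cutoff functions, hence 0. The intersection of such a
    box with any other box is again of this kind, so the pi-lambda argument applies,
    and countably many of them cover [D]. *)
Lemma ae_eq0_test n (D : set 'rV[R]_n) (f : 'rV[R]_n -> R) : open D ->
  (forall K, compact K -> K `<=` D -> (lebesgue_rV n).-integrable K (EFin \o f)) ->
  (forall phi, C1c D phi -> \int[lebesgue_rV n]_(x in D) (f x * phi x) = 0) ->
  {ae lebesgue_rV n, forall x, D x -> f x = 0}.
Proof.
move=> oD fi f0.
have bi a b : cbox a b `<=` D -> (lebesgue_rV n).-integrable (box a b) (EFin \o f).
  move=> abD; have := fi _ (@cbox_compact _ _ a b) abD.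
  apply: integrableS; [|exact: measurable_box|exact: box_cbox].
  by apply: compact_measurable_rV; exact: cbox_compact.
have b0 a b : cbox a b `<=` D ->
    (\int[lebesgue_rV n]_(x in box a b) (f x)%:E = 0)%E.
  move=> abD; apply: (integral_eq0_limit (D := D) (chi := cutoff a b)).
  - exact: open_measurable_rV.
  - exact: measurable_box.
  - exact: subset_trans (@box_cbox _ _ a b) abD.
  - exact: bi.
  - move=> k; have [c1 _] := (C1cP _ _).1 (cutoff_C1c k abD).
    by apply: continuous_measurable_rV; exact: C1_continuous.
  - by move=> k x; rewrite cutoff_ge0 cutoff_le1.
  - by move=> k x; exact: cutoff_notin.
  - exact: cutoff_in.
  - by move=> k; apply/f0/cutoff_C1c.
have H (q : 'rV[rat]_n * 'rV[rat]_n) : cbox (rat_row q.1) (rat_row q.2) `<=` D ->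
    {ae lebesgue_rV n, forall x, box (rat_row q.1) (rat_row q.2) x -> f x = 0}.
  move=> qD.
  have := @ae_eq0_pi_system _ _ _ _ _ (box (rat_row q.1) (rat_row q.2))
    (EFin \o f) (@measurable_boxesE R n) (@boxes_setI R n) (measurable_box _ _)
    (bi _ _ qD) (b0 _ _ qD).
  have aux : forall A, boxes A -> (\int[lebesgue_rV n]_(x in
      A `&` box (rat_row q.1) (rat_row q.2)) (EFin \o f) x = 0)%E.
    move=> _ [a [b ->]]; rewrite boxI; apply: b0.
    exact: subset_trans (@cboxI_sub _ _ _ _ _ _) qD.
  by move=> /(_ aux); apply: filterS => x hx /hx[].
have := ae_forall_countType H.
apply: filterS => x hx Dx; have [q [qx qD]] := open_rat_box oD Dx.
exact: hx qD qx.
Qed.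

(** Products of cutoff functions play the role of the cutoff functions in
    [ae_eq0_test]. *)
Lemma ae_eq0_test2 m n (D : set 'rV[R]_m) (E : set 'rV[R]_n)
    (f : 'rV[R]_m * 'rV[R]_n -> R) : open D -> open E ->
  (forall K, compact K -> K `<=` D `*` E ->
    (lebesgue_rV m \x lebesgue_rV n)%E.-integrable K (EFin \o f)) ->
  (forall psi, C1c (D `*` E) psi ->
    \int[(lebesgue_rV m \x lebesgue_rV n)%E]_(z in D `*` E) (f z * psi z) = 0) ->
  {ae (lebesgue_rV m \x lebesgue_rV n)%E, forall z, (D `*` E) z -> f z = 0}.
Proof.
move=> oD oE fi f0; set mu := (lebesgue_rV m \x lebesgue_rV n)%E.
have mbb (a b : 'rV[R]_m) (c e : 'rV[R]_n) : measurable (box a b `*` box c e).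
  by apply: measurableX; exact: measurable_box.
have sbb (a b : 'rV[R]_m) (c e : 'rV[R]_n) :
    box a b `*` box c e `<=` cbox a b `*` cbox c e.
  by move=> z [/box_cbox ? /box_cbox ?].
have bi (a b : 'rV[R]_m) (c e : 'rV[R]_n) : cbox a b `*` cbox c e `<=` D `*` E ->
    mu.-integrable (box a b `*` box c e) (EFin \o f).
  move=> abD.
  have cc := compact_setX (@cbox_compact _ _ a b) (@cbox_compact _ _ c e).
  have := fi _ cc abD; apply: integrableS => //.
  exact: compact_measurable_rV2.
have b0 (a b : 'rV[R]_m) (c e : 'rV[R]_n) : cbox a b `<=` D -> cbox c e `<=` E ->
    (\int[mu]_(x in box a b `*` box c e) (f x)%:E = 0)%E.
  move=> abD ceE.
  have ccDE : cbox a b `*` cbox c e `<=` D `*` E by move=> z [/abD ? /ceE ?].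
  have tc k := C1c_tensor (cutoff_C1c k abD) (cutoff_C1c k ceE).
  apply: (integral_eq0_limit (D := D `*` E)
    (chi := fun k z => cutoff a b k z.1 * cutoff c e k z.2)) => //.
  - by apply: measurableX; exact: open_measurable_rV.
  - exact: subset_trans ccDE.
  - exact: bi.
  - move=> k; have [c1 _] := (C1cP _ _).1 (tc k).
    by apply: continuous_measurable_rV2; exact: C1_continuous.
  - by move=> k x; rewrite mulr_ge0 ?mulr_ile1 ?cutoff_ge0 ?cutoff_le1.
  - by move=> k x /not_andP[] /cutoff_notin ->; rewrite ?mul0r ?mulr0.
  - move=> x [/cutoff_in h1 /cutoff_in h2].
    by apply: filterS2 h1 h2 => k -> ->; rewrite mulr1.
  - by move=> k; apply/f0.
have H (q : ('rV[rat]_m * 'rV[rat]_m) * ('rV[rat]_n * 'rV[rat]_n)) :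
    (cbox (rat_row q.1.1) (rat_row q.1.2) `<=` D /\
     cbox (rat_row q.2.1) (rat_row q.2.2) `<=` E) ->
    {ae mu, forall x, (box (rat_row q.1.1) (rat_row q.1.2) `*`
     box (rat_row q.2.1) (rat_row q.2.2)) x -> f x = 0}.
  move=> [qD qE].
  have qDE : cbox (rat_row q.1.1) (rat_row q.1.2) `*`
     cbox (rat_row q.2.1) (rat_row q.2.2) `<=` D `*` E by move=> z [/qD ? /qE ?].
  have := @ae_eq0_pi_system _ _ _ _ _ (box (rat_row q.1.1) (rat_row q.1.2) `*`
     box (rat_row q.2.1) (rat_row q.2.2))
    (EFin \o f) (@measurable_boxes2E R m n) (@boxes2_setI R m n) (mbb _ _ _ _)
    (bi _ _ _ _ qDE) (b0 _ _ _ _ qD qE).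
  have aux : forall A, boxes2 A -> (\int[mu]_(x in
      A `&` (box (rat_row q.1.1) (rat_row q.1.2) `*`
     box (rat_row q.2.1) (rat_row q.2.2))) (EFin \o f) x = 0)%E.
    move=> _ [a [b [c [e ->]]]]; rewrite -setXI !boxI; apply: b0.
      exact: subset_trans (@cboxI_sub _ _ _ _ _ _) qD.
    exact: subset_trans (@cboxI_sub _ _ _ _ _ _) qE.
  by move=> /(_ aux); apply: filterS => x hx /hx[].
have := ae_forall_countType H.
apply: filterS => z hz [Dz Ez].
have [q [qz qD]] := open_rat_box oD Dz; have [r [rz rE]] := open_rat_box oE Ez.
exact: (hz (q, r)).
Qed.

End fundamental_lemma.

Section integrability.
Context {R : realType}.

(** The product is dominated by [M] times the restriction of [u] to [K]. *)
Lemma integrable_mul_supp d (T : measurableType d) (mu : {measure set T -> \bar R})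
    (D K : set T) (u h : T -> R) (M : R) :
  measurable D -> measurable K -> K `<=` D ->
  measurable_fun D u -> mu.-integrable K (EFin \o u) ->
  measurable_fun [set: T] h -> (forall x, `|h x| <= M) ->
  (forall x, D x -> ~ K x -> h x = 0) ->
  mu.-integrable D (EFin \o (fun x => u x * h x)).
Proof.
move=> mD mK KD mu0 iu mh hM h0.
have iuK : mu.-integrable D (EFin \o (u \_ K)).
  apply: (@integrableS _ _ _ mu setT) => //.
  by rewrite -restrict_EFin; exact: (integrable_mkcond _ mK).1 iu.
have := integrableZl mD M iuK; apply: le_integrable => //.
  apply/measurable_EFinP/measurable_funM => //; exact: measurable_funTS.
move=> x Dx; rewrite -EFinM !abse_EFin lee_fin patchE.
case: ifPn => [_|].
  by rewrite !normrM mulrC ler_wpM2r// (le_trans (hM x))// ler_norm.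
by rewrite notin_setE => /(h0 _ Dx)->; rewrite !mulr0.
Qed.

Lemma L1loc_Cc n (D : set 'rV[R]_n) u h : open D -> L1loc D u -> Cc D h ->
  (lebesgue_rV n).-integrable D (EFin \o (fun x => u x * h x)).
Proof.
move=> oD [mu0 iu] Ch; have [M M0 hM] := Cc_bounded Ch.
have [ch [K [cK KD h0]]] := Ch.
apply: (@integrable_mul_supp _ _ _ _ K _ _ M) => //.
- exact: open_measurable_rV.
- exact: compact_measurable_rV.
- exact: iu.
- exact: continuous_measurable_rV.
- by move=> x _; exact: h0.
Qed.

Lemma L1loc2_Cc n (D : set 'rV[R]_n) g h : open D -> L1loc2 D g -> Cc (D `*` D) h ->
  (lebesgue_rV n \x lebesgue_rV n)%E.-integrable (D `*` D)
    (EFin \o (fun z => g z * h z)).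
Proof.
move=> oD [mg ig] Ch; have [M M0 hM] := Cc_bounded Ch.
have [ch [K [cK KD h0]]] := Ch.
apply: (@integrable_mul_supp _ _ _ _ K _ _ M) => //.
- by apply: measurableX; exact: open_measurable_rV.
- exact: compact_measurable_rV2.
- exact: ig.
- exact: continuous_measurable_rV2.
- by move=> x _; exact: h0.
Qed.

Lemma L1loc_cst n (D : set 'rV[R]_n) (c : R) : L1loc D (cst c).
Proof.
split=> [|K cK _]; first exact: measurable_cst.
apply: (measurable_bounded_integrable (f := cst c)).
- exact: compact_measurable_rV.
- exact: lebesgue_compact_lty.
- exact: measurable_cst.
- by exists `|c|; split=> // x cx y _ /=; rewrite ltW.
Qed.

Lemma Cc_integrable n (D : set 'rV[R]_n) h : open D -> Cc D h ->
  (lebesgue_rV n).-integrable D (EFin \o h).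
Proof.
move=> oD Ch; have := L1loc_Cc oD (L1loc_cst D 1) Ch.
by under eq_fun do rewrite /= mul1r.
Qed.

Section product.
Context d1 d2 (T1 : measurableType d1) (T2 : measurableType d2).
Variables (m1 : {sigma_finite_measure set T1 -> \bar R})
          (m2 : {sigma_finite_measure set T2 -> \bar R}).
Local Open Scope ereal_scope.

Lemma integral_setX_fst (A : set T1) (B : set T2) (f : T1 -> \bar R) :
  measurable A -> measurable B -> measurable_fun A f ->
  (forall x, 0 <= f x) ->
  \int[m1 \x m2]_(z in A `*` B) f z.1 = (\int[m1]_(x in A) f x) * m2 B.
Proof.
move=> mA mB mf f0.
have mfA : measurable_fun setT (f \_ A) by apply/(measurable_restrictT _ mA).1.
have fA0 x : 0 <= (f \_ A) x by rewrite patchE; case: ifP.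
rewrite integral_mkcond (_ : _ \_ _ = fun z => (f \_ A) z.1 * (\1_B z.2)%:E); last first.
  apply/funext => z; rewrite !patchE in_setX indicE.
  case: (z.1 \in A); case: (z.2 \in B); rewrite /= ?mule1 ?mule0 ?mul0e//.
rewrite fubini_tonelli1/=; last 2 first.
- apply: emeasurable_funM; first exact: measurableT_comp.
  by apply/measurable_EFinP; exact: measurableT_comp.
- by move=> z; rewrite mule_ge0.
rewrite /fubini_F /=; under eq_integral => x _.
  rewrite ge0_integralZl//=; last exact/measurable_EFinP.
  rewrite integral_indic// setIT. over.
by rewrite ge0_integralZr//= -integral_mkcond.
Qed.

Lemma integral_setX_snd (A : set T1) (B : set T2) (f : T2 -> \bar R) :
  measurable A -> measurable B -> measurable_fun B f ->
  (forall x, 0 <= f x) ->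
  \int[m1 \x m2]_(z in A `*` B) f z.2 = m1 A * (\int[m2]_(x in B) f x).
Proof.
move=> mA mB mf f0.
have mfB : measurable_fun setT (f \_ B) by apply/(measurable_restrictT _ mB).1.
have fB0 x : 0 <= (f \_ B) x by rewrite patchE; case: ifP.
rewrite integral_mkcond (_ : _ \_ _ = fun z => (\1_A z.1)%:E * (f \_ B) z.2); last first.
  apply/funext => z; rewrite !patchE in_setX indicE.
  case: (z.1 \in A); case: (z.2 \in B); rewrite /= ?mul1e ?mule0 ?mul0e//.
rewrite fubini_tonelli2/=; last 2 first.
- apply: emeasurable_funM; last exact: measurableT_comp.
  by apply/measurable_EFinP; exact: measurableT_comp.
- by move=> z; rewrite mule_ge0.
rewrite /fubini_G /=; under eq_integral => y _.
  rewrite ge0_integralZr//=; last exact/measurable_EFinP.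
  rewrite integral_indic// setIT. over.
by rewrite ge0_integralZl//= -integral_mkcond.
Qed.

End product.
End integrability.

(** * Fubini's theorem for real-valued integrals, and uniqueness of gradients *)

Section Rfubini.
Context {R : realType} d1 d2 (T1 : measurableType d1) (T2 : measurableType d2).
Variables (m1 : {sigma_finite_measure set T1 -> \bar R})
          (m2 : {sigma_finite_measure set T2 -> \bar R}).
Variables (A : set T1) (B : set T2) (f : T1 * T2 -> R).
Hypotheses (mA : measurable A) (mB : measurable B).
Hypothesis fi : (m1 \x m2)%E.-integrable (A `*` B) (EFin \o f).

Let f0 := f \_ (A `*` B).

Let f0i : (m1 \x m2)%E.-integrable setT (EFin \o f0).
Proof.
rewrite /f0 -restrict_EFin; apply: (integrable_mkcond _ _).1 => //.
exact: measurableX.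
Qed.

Let integrable_fine d (T : measurableType d) (mu : {measure set T -> \bar R})
    (F : T -> \bar R) : mu.-integrable setT F ->
  mu.-integrable setT (EFin \o (fine \o F)).
Proof.
move=> iF; have mF := measurable_int mu iF; apply: le_integrable iF => //.
  by apply/measurable_EFinP; exact: measurableT_comp.
by move=> x _ /=; case: (F x) => [r| |]//=; rewrite normr0 leey.
Qed.

Let Rintegral_fine d (T : measurableType d) (mu : {measure set T -> \bar R})
    (F : T -> \bar R) : mu.-integrable setT F ->
  \int[mu]_x (fine (F x)) = fine (\int[mu]_x F x)%E.
Proof.
move=> iF; congr fine; apply: ae_eq_integral => //.
- exact: measurable_int (integrable_fine iF).
- exact: measurable_int iF.
by have := integrable_ae measurableT iF; apply: filterS => x h _; rewrite fineK ?h.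
Qed.

Let integrable_G (F : T1 * T2 -> \bar R) : (m1 \x m2)%E.-integrable setT F ->
  m2.-integrable setT (fubini_G m1 F).
Proof.
move=> iF; have mF := measurable_int _ iF; have mG := measurable_fubini_G iF.
apply/integrableP; split=> //.
have := (integrable21ltyP m1 m2 mF).1 iF; apply: le_lt_trans.
apply: ge0_le_integral => //.
- exact: measurableT_comp.
- apply: (measurable_fun_fubini_tonelli_G (abse \o F)) => //=.
  exact: measurableT_comp.
- by move=> y _; apply: le_abse_integral => //; exact: measurableT_comp.
Qed.

Let section1 x : A x ->
  \int[m2]_(y in B) f (x, y) = fine (\int[m2]_y (f0 (x, y))%:E)%E.
Proof.
move=> Ax; rewrite Rintegral_mkcond /Rintegral; congr fine.
apply: eq_integral => y _; rewrite /f0 !patchE in_setX/= (mem_set Ax)/=.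
by [].
Qed.

Let section1_out x : ~ A x -> (\int[m2]_y (f0 (x, y))%:E)%E = 0%E.
Proof.
move=> nA; rewrite integral0_eq// => y _.
by rewrite /f0 patchE in_setX/= (memNset nA).
Qed.

Let section2 y : B y ->
  \int[m1]_(x in A) f (x, y) = fine (\int[m1]_x (f0 (x, y))%:E)%E.
Proof.
move=> By; rewrite Rintegral_mkcond /Rintegral; congr fine.
by apply: eq_integral => x _; rewrite /f0 !patchE in_setX/= (mem_set By)/= andbT.
Qed.

Let section2_out y : ~ B y -> (\int[m1]_x (f0 (x, y))%:E)%E = 0%E.
Proof.
move=> nB; rewrite integral0_eq// => x _.
by rewrite /f0 patchE in_setX/= (memNset nB) andbF.
Qed.

Let restr1 : (fun x => \int[m2]_(y in B) f (x, y)) \_ A =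
  fine \o (fun x => (\int[m2]_y (f0 (x, y))%:E)%E).
Proof.
apply/funext => x; rewrite patchE /=; case: ifPn => [/set_mem|].
  exact: section1.
by rewrite notin_setE => nA; rewrite section1_out.
Qed.

Let restr2 : (fun y => \int[m1]_(x in A) f (x, y)) \_ B =
  fine \o (fun y => (\int[m1]_x (f0 (x, y))%:E)%E).
Proof.
apply/funext => x; rewrite patchE /=; case: ifPn => [/set_mem|].
  exact: section2.
by rewrite notin_setE => nB; rewrite section2_out.
Qed.

(** The real-valued inner integral is 0 by convention where the extended one is
    infinite, which happens on a null set only. *)
Lemma Rintegral_integrable12 :
  m1.-integrable A (EFin \o (fun x => \int[m2]_(y in B) f (x, y))).
Proof.
apply: (integrable_mkcond _ _).2 => //; rewrite restrict_EFin restr1.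
exact: (integrable_fine (integrable_fubini_F f0i)).
Qed.

Lemma Rintegral_integrable21 :
  m2.-integrable B (EFin \o (fun y => \int[m1]_(x in A) f (x, y))).
Proof.
apply: (integrable_mkcond _ _).2 => //; rewrite restrict_EFin restr2.
exact: (integrable_fine (integrable_G f0i)).
Qed.

Lemma Rfubini12 : \int[m1]_(x in A) \int[m2]_(y in B) f (x, y) =
  \int[(m1 \x m2)%E]_(z in A `*` B) f z.
Proof.
rewrite Rintegral_mkcond restr1 [RHS]Rintegral_mkcond.
rewrite [LHS](Rintegral_fine (integrable_fubini_F f0i)).
by rewrite [X in fine X](integral12_prod_meas1 f0i).
Qed.

Lemma Rfubini21 : \int[m2]_(y in B) \int[m1]_(x in A) f (x, y) =
  \int[(m1 \x m2)%E]_(z in A `*` B) f z.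
Proof.
rewrite Rintegral_mkcond restr2 [RHS]Rintegral_mkcond.
rewrite [LHS](Rintegral_fine (integrable_G f0i)).
by rewrite [X in fine X](integral21_prod_meas1 f0i).
Qed.

End Rfubini.

Lemma measurable_Rintegral12 {R : realType} d1 d2 (T1 : measurableType d1)
    (T2 : measurableType d2) (m2 : {sigma_finite_measure set T2 -> \bar R})
    (A : set T1) (B : set T2) (f : T1 * T2 -> R) :
  measurable A -> measurable B -> measurable_fun (A `*` B) f ->
  measurable_fun A (fun x => \int[m2]_(y in B) f (x, y)).
Proof.
move=> mA mB mf; pose F := EFin \o (f \_ (A `*` B)).
have mF : measurable_fun setT F.
  apply/measurable_EFinP; apply: (measurable_restrictT _ _).1 mf.
  exact: measurableX.
have mI : measurable_fun A (fine \o (fun x => (\int[m2]_y F (x, y))%E)).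
  apply: measurable_funTS; apply: measurableT_comp => //.
  rewrite (_ : (fun x => _) = fubini_F m2 F^\+ \- fubini_F m2 F^\-)%E.
    apply: emeasurable_funB; apply: measurable_fun_fubini_tonelli_F => //.
      exact: measurable_funepos.
    exact: measurable_funeneg.
  apply/funext => x; rewrite [LHS]integralE; congr (_ - _)%E.
    by apply: eq_integral => y _; rewrite !funeposE.
  by apply: eq_integral => y _; rewrite !funenegE.
apply: eq_measurable_fun mI => x /set_mem Ax /=.
rewrite Rintegral_mkcond /Rintegral; congr fine; apply: eq_integral => y _.
by rewrite /F /= !patchE in_setX/= (mem_set Ax).
Qed.

Section L1loc2.
Context {R : realType} {N : nat}.
Local Notation RN := 'rV[R]_N.
Local Notation leb := (@lebesgue_rV R N).
Local Notation leb2 := (leb \x leb)%E.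

(** A compact subset of the product is contained in the product of its
    projections, and the second one has finite measure. *)
Lemma L1loc2_fst (D : set RN) u : open D -> L1loc D u -> L1loc2 D (fun z => u z.1).
Proof.
move=> oD [mu iu]; have mD := open_measurable_rV oD; split.
  apply: (measurable_comp mD) mu _; last exact: measurable_funTS.
  by move=> _ [z [? _] <-].
move=> K cK KD; have [cK1 cK2 K12] := compact_proj cK.
have mK1 := compact_measurable_rV cK1; have mK2 := compact_measurable_rV cK2.
have K1D : fst @` K `<=` D by move=> _ [z /KD[? _] <-].
have iK1 := iu _ cK1 K1D.
apply: (@integrableS _ _ _ leb2 ((fst @` K) `*` (snd @` K))) => //.
- exact: measurableX.
- exact: compact_measurable_rV2.
apply/integrableP; split.
  apply/measurable_EFinP; apply: (measurable_comp mK1 _ (measurable_funS mD K1D mu)).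
    by move=> _ [z [? _] <-].
  exact: measurable_funTS.
rewrite (integral_setX_fst _ _ (f := fun x => `|(u x)%:E|%E))//; last first.
  by apply: measurableT_comp => //; exact: measurable_int iK1.
have [_ fin1] := integrableP _ _ _ iK1.
by rewrite lte_mul_pinfty// ?ge0_fin_numE ?integral_ge0// lebesgue_compact_lty.
Qed.

Lemma L1loc2_snd (D : set RN) u : open D -> L1loc D u -> L1loc2 D (fun z => u z.2).
Proof.
move=> oD [mu iu]; have mD := open_measurable_rV oD; split.
  apply: (measurable_comp mD) mu _; last exact: measurable_funTS.
  by move=> _ [z [_ ?] <-].
move=> K cK KD; have [cK1 cK2 K12] := compact_proj cK.
have mK1 := compact_measurable_rV cK1; have mK2 := compact_measurable_rV cK2.
have K2D : snd @` K `<=` D by move=> _ [z /KD[_ ?] <-].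
have iK2 := iu _ cK2 K2D.
apply: (@integrableS _ _ _ leb2 ((fst @` K) `*` (snd @` K))) => //.
- exact: measurableX.
- exact: compact_measurable_rV2.
apply/integrableP; split.
  apply/measurable_EFinP; apply: (measurable_comp mK2 _ (measurable_funS mD K2D mu)).
    by move=> _ [z [_ ?] <-].
  exact: measurable_funTS.
rewrite (integral_setX_snd _ _ (f := fun x => `|(u x)%:E|%E))//; last first.
  by apply: measurableT_comp => //; exact: measurable_int iK2.
have [_ fin2] := integrableP _ _ _ iK2.
by rewrite lte_mul_pinfty// ?ge0_fin_numE ?integral_ge0// lebesgue_compact_lty.
Qed.

Lemma L1locB (D : set RN) u v : L1loc D u -> L1loc D v -> L1loc D (fun x => u x - v x).
Proof.
move=> [mu iu] [mv iv]; split=> [|K cK KD]; first exact: measurable_funB.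
have := integrableB (compact_measurable_rV cK) (iu _ cK KD) (iv _ cK KD).
exact.
Qed.

Lemma L1loc2B (D : set RN) u v :
  L1loc2 D u -> L1loc2 D v -> L1loc2 D (fun x => u x - v x).
Proof.
move=> [mu iu] [mv iv]; split=> [|K cK KD]; first exact: measurable_funB.
have := integrableB (compact_measurable_rV2 cK) (iu _ cK KD) (iv _ cK KD).
exact.
Qed.

Lemma weak_partial_unique (D : set RN) i u g h : open D ->
  is_weak_partial D i u g -> is_weak_partial D i u h ->
  {ae leb, forall x, D x -> g x = h x}.
Proof.
move=> oD [_ lg gE] [_ lh hE].
have := @ae_eq0_test _ _ _ (fun x => g x - h x) oD (L1locB lg lh).2.
have aux phi : C1c D phi -> \int[leb]_(x in D) ((g x - h x) * phi x) = 0.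
  move=> cphi; have [_ Cphi] := (C1cP _ _).1 cphi.
  under eq_Rintegral do rewrite mulrBl.
  rewrite RintegralB; [|exact: open_measurable_rV|exact: L1loc_Cc|exact: L1loc_Cc].
  by apply/eqP; rewrite subr_eq0 -eqr_opp -gE// -hE.
by move=> /(_ aux); apply: filterS => x hx Dx; apply/eqP; rewrite -subr_eq0 hx.
Qed.

Lemma nonlocal_partial_unique (D : set RN) i u g h : open D ->
  is_nonlocal_partial D i u g -> is_nonlocal_partial D i u h ->
  {ae leb2, forall z, (D `*` D) z -> g z = h z}.
Proof.
move=> oD [_ lg gE] [_ lh hE].
have := @ae_eq0_test2 _ _ _ _ _ (fun x => g x - h x) oD oD (L1loc2B lg lh).2.
have aux psi : C1c (D `*` D) psi ->
    \int[leb2]_(z in D `*` D) ((g z - h z) * psi z) = 0.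
  move=> cpsi; have [_ Cpsi] := (C1cP _ _).1 cpsi.
  have mD := open_measurable_rV oD.
  under eq_Rintegral do rewrite mulrBl.
  rewrite RintegralB; [|exact: measurableX|exact: L1loc2_Cc|exact: L1loc2_Cc].
  by apply/eqP; rewrite subr_eq0 -eqr_opp -gE// -hE.
by move=> /(_ aux); apply: filterS => x hx Dx; apply/eqP; rewrite -subr_eq0 hx.
Qed.

End L1loc2.

(** * From weak to nonlocal derivatives and back *)

Section gradients.
Context {R : realType} {N : nat}.
Local Notation RN := 'rV[R]_N.
Local Notation leb := (@lebesgue_rV R N).
Local Notation leb2 := (leb \x leb)%E.

Lemma Cc_scale (V : normedModType R) (D : set V) f c :
  Cc D f -> Cc D (fun x => c * f x).
Proof.
move=> [cf [K [cK KD f0]]]; split; last first.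
  by exists K; split=> // x /f0->; rewrite mulr0.
move=> x; exact: (cvgM (cvg_cst c) (cf x)).
Qed.

Lemma C1c_scale (V : normedModType R) (D : set V) f c :
  C1c D f -> C1c D (fun x => c * f x).
Proof.
move=> /C1cP[c1 cc]; apply/C1cP; split; last exact: Cc_scale.
by apply: C1M => //; exact: C1_cst.
Qed.

(** If the integrals of all cutoff functions of a box vanished, so would the measure
    of the box. *)
Lemma exists_unit_C1c (D : set RN) : open D -> D !=set0 ->
  exists2 eta, C1c D eta & \int[leb]_(x in D) eta x = 1.
Proof.
move=> oD [x Dx]; have [[p q] /= [xpq pqD]] := open_rat_box oD Dx.
pose eta k : RN -> R := cutoff (rat_row p) (rat_row q) k.
suff [k ek] : exists k, \int[leb]_(x in D) eta k x != 0.
  exists (fun x => (\int[leb]_(x in D) eta k x)^-1 * eta k x).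
    exact/C1c_scale/cutoff_C1c.
  rewrite RintegralZl ?mulVf//; first exact: open_measurable_rV.
  have [_ Ck] := (C1cP _ _).1 (cutoff_C1c k pqD).
  exact: Cc_integrable.
apply: contrapT => /forallNP h.
have lt_pq i : (rat_row p : RN) ord0 i < (rat_row q : RN) ord0 i.
  by have /andP[] := xpq i; exact: lt_trans.
have := lebesgue_box_gt0 lt_pq; rewrite ltNge => /negP; apply.
rewrite -[leLHS]mul1e -integral_cst; last exact: measurable_box.
rewrite (integral_eq0_limit (D := D) (f := cst 1) (chi := eta))//.
- exact: open_measurable_rV.
- exact: measurable_box.
- exact: subset_trans (@box_cbox _ _ _ _) pqD.
- have [_ /(_ _ (@cbox_compact _ _ (rat_row p) (rat_row q)) pqD)] :=
    L1loc_cst D 1.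
  apply: integrableS; [|exact: measurable_box|exact: box_cbox].
  by apply: compact_measurable_rV; exact: cbox_compact.
- move=> k; have [c1 _] := (C1cP _ _).1 (cutoff_C1c k pqD).
  by apply: continuous_measurable_rV; exact: C1_continuous.
- by move=> k y; rewrite cutoff_ge0 cutoff_le1.
- by move=> k y; exact: cutoff_notin.
- exact: cutoff_in.
- move=> k; under eq_Rintegral do rewrite mul1r.
  by apply: contrapT => /eqP; exact: h.
Qed.

Lemma RintegralN (D : set RN) (f : RN -> R) : measurable D ->
  leb.-integrable D (EFin \o f) ->
  \int[leb]_(x in D) - f x = - \int[leb]_(x in D) f x.
Proof.
by move=> mD fi; under eq_Rintegral do rewrite -mulN1r; rewrite RintegralZl// mulN1r.
Qed.

Lemma nonlocal_adjointE (D : set RN) i psi x : open D -> C1c (D `*` D) psi ->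
  nonlocal_adjoint D i psi x =
  \int[leb]_(y in D) 'D_(0, basis_vec i) psi (y, x) -
  \int[leb]_(y in D) 'D_(basis_vec i, 0) psi (x, y).
Proof.
move=> oD cpsi; rewrite /nonlocal_adjoint.
have -> : (fun y => 'D_(basis_vec i) (fun x' : RN => psi (y, x') - psi (x', y)) x) =
  (fun y => 'D_(0, basis_vec i) psi (y, x) - 'D_(basis_vec i, 0) psi (x, y)).
  apply/funext => y; rewrite -derive_section1 -derive_section2.
  have [[d1 _] _] := (C1cP _ _).1 (C1c_section1 y cpsi).
  have [[d2 _] _] := (C1cP _ _).1 (C1c_section2 y cpsi).
  by rewrite -deriveB//; exact: diff_derivable.
apply: RintegralB; first exact: open_measurable_rV.
- exact: Cc_integrable (Cc_section1 x (C1c_derive _ cpsi)).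
- exact: Cc_integrable (Cc_section2 x (C1c_derive _ cpsi)).
Qed.

(** By Fubini's theorem the two terms of the nonlocal adjoint reduce to the weak
    identity for the sections of [psi] in its second, respectively its first
    variable. *)
Lemma weak_to_nonlocal (D : set RN) i u g : open D ->
  is_weak_partial D i u g -> is_nonlocal_partial D i u (fun z => g z.2 - g z.1).
Proof.
move=> oD [lu lg gE]; have mD := open_measurable_rV oD.
have lu1 := L1loc2_fst oD lu; have lu2 := L1loc2_snd oD lu.
have lg1 := L1loc2_fst oD lg; have lg2 := L1loc2_snd oD lg.
split=> // [|psi cpsi]; first exact: L1loc2B.
have [_ Cpsi] := (C1cP _ _).1 cpsi.
pose e := basis_vec i : RN.
have C1 := C1c_derive (0, e) cpsi; have C2 := C1c_derive (e, 0) cpsi.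
have i1 := L1loc2_Cc oD lu2 C1; have i2 := L1loc2_Cc oD lu1 C2.
have j1 := L1loc2_Cc oD lg2 Cpsi; have j2 := L1loc2_Cc oD lg1 Cpsi.
transitivity (\int[leb]_(x in D) (
    \int[leb]_(y in D) (u x * 'D_(0, e) psi (y, x)) -
    \int[leb]_(y in D) (u x * 'D_(e, 0) psi (x, y)))).
  apply: eq_Rintegral => x _; rewrite nonlocal_adjointE// mulrBr.
  have k1 := Cc_integrable oD (Cc_section1 x C1).
  have k2 := Cc_integrable oD (Cc_section2 x C2).
  by rewrite (RintegralZl _ mD k1) (RintegralZl _ mD k2).
rewrite RintegralB//; last 2 first.
- exact: (Rintegral_integrable21 mD mD i1).
- exact: (Rintegral_integrable12 mD mD i2).
have e1 : \int[leb2]_(z in D `*` D) (u z.2 * 'D_(0, e) psi z) =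
    - \int[leb2]_(z in D `*` D) (g z.2 * psi z).
  rewrite -[LHS](Rfubini12 mD mD i1) -[X in - X](Rfubini12 mD mD j1).
  rewrite -RintegralN//; last first.
    exact: (Rintegral_integrable12 mD mD j1).
  apply: eq_Rintegral => y _ /=; under eq_Rintegral do rewrite -derive_section2.
  by apply: gE; exact: C1c_section2 cpsi.
have e2 : \int[leb2]_(z in D `*` D) (u z.1 * 'D_(e, 0) psi z) =
    - \int[leb2]_(z in D `*` D) (g z.1 * psi z).
  rewrite -[LHS](Rfubini21 mD mD i2) -[X in - X](Rfubini21 mD mD j2).
  rewrite -RintegralN//; last first.
    exact: (Rintegral_integrable21 mD mD j2).
  apply: eq_Rintegral => y _ /=; under eq_Rintegral do rewrite -derive_section1.
  by apply: gE; exact: C1c_section1 cpsi.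
rewrite [X in X - _](etrans (Rfubini21 mD mD i1) e1).
rewrite [X in _ - X](etrans (Rfubini12 mD mD i2) e2).
under [in RHS]eq_Rintegral do rewrite mulrBl.
by rewrite [in RHS]RintegralB//; [rewrite opprB opprK addrC|exact: measurableX].
Qed.

(** The part of the recovered derivative that comes from the nonlocal one, see
    [nonlocal_to_weak]. *)
Definition section_mean (D : set RN) (g : RN * RN -> R) (eta : RN -> R) (x : RN) : R :=
  \int[leb]_(y in D) (g (x, y) * eta y).

Lemma integrable_tensor_supp (D K : set RN) g eta : open D -> L1loc2 D g ->
  compact K -> K `<=` D -> Cc D eta ->
  leb2.-integrable (K `*` D) (EFin \o (fun z => g z * eta z.2)).
Proof.
move=> oD [mg ig] cK KD Ce; have [M M0 hM] := Cc_bounded Ce.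
have [ce [L [cL LD e0]]] := Ce.
have mK := compact_measurable_rV cK; have mL := compact_measurable_rV cL.
have mD := open_measurable_rV oD.
apply: (@integrable_mul_supp _ _ _ _ _ (K `*` L) g (fun z => eta z.2) M) => //.
- exact: measurableX.
- exact: measurableX.
- by move=> z [? /LD].
- by apply: measurable_funS mg; [exact: measurableX|move=> z [/KD ? ?]].
- by apply: ig; [exact: compact_setX|move=> z [/KD ? /LD ?]].
- by apply: measurableT_comp => //; exact: continuous_measurable_rV.
- by move=> z [Kz _] nKL; apply: e0 => Lz; apply: nKL.
Qed.

Lemma L1loc_section_mean (D : set RN) g eta : open D -> L1loc2 D g -> Cc D eta ->
  L1loc D (section_mean D g eta).
Proof.
move=> oD lg Ce; have mD := open_measurable_rV oD; split.
  apply: (@measurable_Rintegral12 _ _ _ _ _ leb D D (fun z => g z * eta z.2)) => //.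
  apply: measurable_funM; first exact: lg.1.
  apply: measurable_funTS; apply: measurableT_comp => //.
  exact: continuous_measurable_rV Ce.1.
move=> K cK KD; have mK := compact_measurable_rV cK.
exact: (Rintegral_integrable12 mK mD (integrable_tensor_supp oD lg cK KD Ce)).
Qed.

(** Fubini's theorem; [phi x] leaves the inner integral only for those [x] whose
    section is integrable, hence the almost everywhere argument. *)
Lemma Rintegral_section_mean (D : set RN) g phi eta : open D -> L1loc2 D g ->
  C1c D phi -> C1c D eta ->
  \int[leb2]_(z in D `*` D) (g z * (phi z.1 * eta z.2)) =
  \int[leb]_(x in D) (section_mean D g eta x * phi x).
Proof.
move=> oD lg cphi ceta; have mD := open_measurable_rV oD.
have [c1 Cphi] := (C1cP _ _).1 cphi; have [_ Ceta] := (C1cP _ _).1 ceta.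
have [_ Ct] := (C1cP _ _).1 (C1c_tensor cphi ceta).
have it := L1loc2_Cc oD lg Ct; rewrite -(Rfubini12 mD mD it).
have ls := L1loc_section_mean oD lg Ceta.
congr fine; apply: ae_eq_integral => //.
- exact: measurable_int (Rintegral_integrable12 mD mD it).
- exact: measurable_int (L1loc_Cc oD ls Cphi).
have [_ [K [cK KD phi0]]] := Cphi.
have mK := compact_measurable_rV cK.
have iK := integrable_tensor_supp oD lg cK KD Ceta.
have := ae_integrable1 ((integrable_mkcond _ (measurableX mK mD)).1 iK).
apply: filterS => x hx Dx /=; congr EFin.
have [Kx|nKx] := pselect (K x); last first.
  rewrite phi0// mulr0; under eq_Rintegral do rewrite mul0r mulr0.
  by rewrite Rintegral_cst// mul0r.
under eq_Rintegral do rewrite /= mulrCA.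
rewrite RintegralZl// 1?mulrC//.
apply: (integrable_mkcond _ mD).2; move: hx.
set F := (X in leb.-integrable _ X -> _); set G := (X in _ -> leb.-integrable _ X).
suff -> : F = G by [].
apply/funext => y; rewrite /F /G.
by rewrite !patchE in_setX/= (mem_set Kx).
Qed.

(** For [psi z = phi z.1 * eta z.2] the nonlocal adjoint is
    [(int phi) * D_i eta - D_i phi], because [eta] has integral 1. *)
Lemma nonlocal_to_weak (D : set RN) i u g eta : open D ->
  C1c D eta -> \int[leb]_(x in D) eta x = 1 ->
  is_nonlocal_partial D i u g ->
  is_weak_partial D i u (fun x =>
    - (\int[leb]_(x in D) (u x * 'D_(basis_vec i) eta x)) - section_mean D g eta x).
Proof.
move=> oD ceta eta1 [lu lg gE]; have mD := open_measurable_rV oD.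
have [ceta1 Ceta] := (C1cP _ _).1 ceta.
have ls := L1loc_section_mean oD lg Ceta.
split=> // [|phi cphi]; first exact: (L1locB (L1loc_cst D _) ls).
have [cphi1 Cphi] := (C1cP _ _).1 cphi.
pose e := basis_vec i : RN.
set c := \int[leb]_(x in D) (u x * 'D_e eta x).
have ct := C1c_tensor cphi ceta.
have iphi := Cc_integrable oD Cphi; have ieta := Cc_integrable oD Ceta.
have idphi := L1loc_Cc oD lu (C1c_derive e cphi).
have ideta := L1loc_Cc oD lu (C1c_derive e ceta).
have isphi := L1loc_Cc oD ls Cphi.
have := gE _ ct; rewrite Rintegral_section_mean//.
have -> : \int[leb]_(x in D) (u x * nonlocal_adjoint D i (fun z => phi z.1 * eta z.2) x)
   = \int[leb]_(x in D) phi x * c - \int[leb]_(x in D) (u x * 'D_e phi x).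
  have ic : leb.-integrable D
      (EFin \o (fun x => \int[leb]_(y in D) phi y * (u x * 'D_e eta x))).
    exact: (integrableZl mD (\int[leb]_(y in D) phi y) ideta).
  rewrite -(RintegralZl _ mD ideta) -(RintegralB mD ic idphi).
  apply: eq_Rintegral => x _; rewrite nonlocal_adjointE//.
  have deta : derivable eta x e by apply: diff_derivable; exact: ceta1.1.
  have deriveMc c' : 'D_e (fun y => c' * eta y) x = c' * 'D_e eta x.
    exact: (deriveMl c' deta).
  have dphi : derivable phi x e by apply: diff_derivable; exact: cphi1.1.
  have -> : \int[leb]_(y in D) 'D_(0, e) (fun z => phi z.1 * eta z.2) (y, x) =
      \int[leb]_(y in D) phi y * 'D_e eta x.
    rewrite -(RintegralZr _ mD iphi); apply: eq_Rintegral => y _.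
    by rewrite -derive_section2 /= deriveMc.
  have -> : \int[leb]_(y in D) 'D_(e, 0) (fun z => phi z.1 * eta z.2) (x, y) =
      'D_e phi x.
    rewrite -[RHS]mulr1 -eta1 -(RintegralZl _ mD ieta).
    by apply: eq_Rintegral => y _; rewrite -derive_section1/= deriveMr// mulrC.
  by rewrite mulrBr mulrCA.
have icphi : leb.-integrable D (EFin \o (fun x => - c * phi x)).
  exact: (integrableZl mD (- c) iphi).
move=> h; under [in RHS]eq_Rintegral do rewrite mulrBl.
rewrite [X in - X](RintegralB mD icphi isphi) (RintegralZl _ mD iphi).
by move: h => /eqP; rewrite subr_eq => /eqP; rewrite mulrC; lra.
Qed.

End gradients.

(** * Lp norms on one space *)

Section Lnorm_lemmas.
Context {R : realType}.
Local Open Scope ereal_scope.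

Lemma le_poweR (x y : \bar R) (r : R) : (0 <= r)%R -> 0 <= x -> x <= y ->
  x `^ r <= y `^ r.
Proof.
move=> r0 x0 xy; apply: gt0_ler_poweR => //; rewrite in_itv/= leey andbT//.
exact: le_trans xy.
Qed.

Section one_measure.
Context d (T : measurableType d) (mu : {measure set T -> \bar R}).
Implicit Types f g : T -> R.

(** The case where the whole space is null is treated apart because the norm is then
    0 by convention. *)
Lemma Lnormy_ge f : {ae mu, forall x, `|(f x)%:E| <= 'N[mu]_+oo[EFin \o f]}.
Proof.
rewrite unlock; case: ifPn => [_|]; first exact: (ess_sup_ge mu (abse \o (EFin \o f))).
rewrite -leNgt measure_le0 => /eqP mu0.
by exists setT; split.
Qed.

Lemma Lnormy_le f y : 0 <= y -> {ae mu, forall x, `|(f x)%:E| <= y} ->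
  'N[mu]_+oo[EFin \o f] <= y.
Proof. by move=> y0 fy; rewrite unlock; case: ifPn => // _; exact/ess_supP. Qed.

Lemma Lnorm_real f r : 'N[mu]_r%:E[EFin \o f] = (\int[mu]_x `|(f x)%:E| `^ r) `^ r^-1.
Proof. by rewrite unlock. Qed.

Lemma measurable_norm_power f r : measurable_fun setT f ->
  measurable_fun setT (fun x => `|(f x)%:E| `^ r).
Proof.
move=> /measurable_EFinP mf.
apply: (@measurableT_comp _ _ _ _ _ _ (fun x : \bar R => x `^ r)) => //.
  exact: measurable_poweR.
exact: measurableT_comp.
Qed.

Lemma le_Lnorm p f g : 1 <= p -> measurable_fun setT f -> measurable_fun setT g ->
  {ae mu, forall x, (`|f x| <= `|g x|)%R} ->
  'N[mu]_p[EFin \o f] <= 'N[mu]_p[EFin \o g].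
Proof.
case: p => [r||//] p1 mf mg fg.
  have r0 : (0 <= r)%R by rewrite -lee_fin (le_trans _ p1).
  rewrite !Lnorm_real; apply: le_poweR; first by rewrite invr_ge0.
    by apply: integral_ge0 => x _; exact: poweR_ge0.
  apply: ae_ge0_le_integral => //.
  - by move=> x _; exact: poweR_ge0.
  - exact: measurable_norm_power.
  - by move=> x _; exact: poweR_ge0.
  - exact: measurable_norm_power.
  by apply: filterS fg => x fgx _; apply: le_poweR.
apply: Lnormy_le; first exact: Lnorm_ge0.
by apply: filterS2 fg (Lnormy_ge g) => x h1 h2; apply: le_trans h2.
Qed.

(** Hoelder's inequality for all exponents at once: [eta], being bounded and
    supported in a set of finite measure, has a finite norm for the conjugate
    exponent. A positive constant makes the bound trivial for functions of
    infinite norm. *)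
Lemma Lnorm_pairing p (K : set T) (eta : T -> R) (M : R) : 1 <= p ->
  measurable K -> mu K < +oo -> measurable_fun setT eta ->
  (forall x, `|eta x| <= M)%R -> (forall x, ~ K x -> eta x = 0%R) ->
  exists2 C : R, (0 < C)%R & forall f, measurable_fun setT f ->
    \int[mu]_x `|(f x * eta x)%:E| <= C%:E * 'N[mu]_p[EFin \o f].
Proof.
move=> p1 mK muK me eM e0.
have muKfin : mu K \is a fin_num by rewrite ge0_fin_numE.
have M1 x : (`|eta x| <= `|M| + 1)%R.
  by rewrite (le_trans (eM x))// (le_trans (ler_norm _))// lerDl.
have M10 : (0 < `|M| + 1)%R by rewrite ltr_wpDl.
move: (`|M| + 1)%R M1 M10 => L M1 M10; move: (L : R) M1 M10 => {}L M1 M10.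
have mfe f : measurable_fun setT f ->
    measurable_fun setT (fun x => `|(f x * eta x)%:E|).
  move=> mf; have mfe := measurable_funM mf me.
    by apply: measurableT_comp => //; exact/measurable_EFinP.
have etaK x : (`|eta x| <= L * \1_K x)%R.
  rewrite indicE; case: (boolP (x \in K)) => [_|]; first by rewrite mulr1.
  by rewrite notin_setE => /e0->; rewrite normr0 mulr0.
have iK : \int[mu]_x (L * \1_K x)%:E = L%:E * mu K.
  under eq_integral do rewrite EFinM.
  rewrite ge0_integralZl//; last by rewrite lee_fin ltW.
    by rewrite integral_indic// setIT.
  by apply/measurable_EFinP.
case: p p1 => [r||//] p1; last first.
  exists (L * fine (mu K) + 1)%R.
    by rewrite ltr_wpDl// mulr_ge0 ?fine_ge0// ltW.
  move=> f mf; set S := Lnorm _ _ _.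
  have S0 : 0 <= S by exact: Lnorm_ge0.
  apply: (@le_trans _ _ (\int[mu]_x (S * (L * \1_K x)%:E))).
    apply: ae_ge0_le_integral => //.
    - exact: mfe.
    - by move=> x _; rewrite mule_ge0// lee_fin mulr_ge0// ltW.
    - apply: emeasurable_funM => //; apply/measurable_EFinP/measurable_funM => //.
    apply: filterS (Lnormy_ge f) => x fx _; rewrite EFinM abseM.
    by apply: lee_pmul => //; rewrite lee_fin.
  rewrite ge0_integralZl//; last 2 first.
  - by apply/measurable_EFinP/measurable_funM.
  - by move=> x _; rewrite lee_fin mulr_ge0// ltW.
  have h : L%:E * mu K <= (L * fine (mu K) + 1)%:E.
    by rewrite EFinD EFinM fineK// leeDl.
  by rewrite iK [leLHS]muleC; exact: lee_wpmul2r.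
move: p1; rewrite lee_fin le_eqVlt => /predU1P[<-|r1].
  exists L => // f mf; have mEf : measurable_fun setT (EFin \o f).
    exact/measurable_EFinP.
  have mnf : measurable_fun setT (abse \o (EFin \o f)) by exact: measurableT_comp.
  rewrite Lnorm1 -ge0_integralZl//; last by rewrite lee_fin ltW.
  apply: ge0_le_integral => //.
  - exact: mfe.
  - exact: emeasurable_funM.
  by move=> x _; rewrite EFinM abseM muleC lee_wpmul2r// abse_EFin lee_fin.
(* The conjugate exponent of [r]. *)
pose q := (r / (r - 1))%R.
have r0 : (0 < r)%R := lt_trans ltr01 r1.
have q0 : (0 < q)%R by rewrite divr_gt0// subr_gt0.
have rq : (r^-1 + q^-1 = 1)%R.
  rewrite /q invf_div; field; rewrite gt_eqF//=.
have Nq : 'N[mu]_q%:E[EFin \o eta] < +oo.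
  rewrite Lnorm_real; apply: poweR_lty.
  apply: (@le_lt_trans _ _ (\int[mu]_x ((L `^ q) * \1_K x)%:E)).
    apply: ge0_le_integral => //.
    - by move=> x _; exact: poweR_ge0.
    - exact: measurable_norm_power.
    - by apply/measurable_EFinP/measurable_funM.
    move=> x _; rewrite abse_EFin poweR_EFin lee_fin indicE.
    case: (boolP (x \in K)) => [_|].
      by rewrite mulr1 ge0_ler_powR ?nnegrE// ltW.
    by rewrite notin_setE => /e0->; rewrite normr0 powR0 ?gt_eqF// mulr0.
  under eq_integral do rewrite EFinM.
  rewrite ge0_integralZl//; last by rewrite lee_fin powR_ge0.
    by rewrite integral_indic// setIT lte_mul_pinfty// lee_fin powR_ge0.
  by apply/measurable_EFinP.
have N0 := Lnorm_ge0 mu q%:E (EFin \o eta).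
have Nqfin : 'N[mu]_q%:E[EFin \o eta] \is a fin_num by rewrite ge0_fin_numE.
exists (fine 'N[mu]_q%:E[EFin \o eta] + 1)%R.
  by rewrite ltr_wpDl// fine_ge0.
move=> f mf; have := hoelder mu mf me r0 q0 rq; rewrite Lnorm1 => /le_trans; apply.
have h : 'N[mu]_q%:E[EFin \o eta] <= (fine 'N[mu]_q%:E[EFin \o eta] + 1)%:E.
  by rewrite EFinD fineK// leeDl.
by rewrite [leLHS]muleC lee_wpmul2r ?Lnorm_ge0.
Qed.

End one_measure.
End Lnorm_lemmas.

(** * Lp norms on product spaces *)

Section product_norms.
Context {R : realType} d1 d2 (T1 : measurableType d1) (T2 : measurableType d2).
Variables (m1 : {sigma_finite_measure set T1 -> \bar R})
          (m2 : {sigma_finite_measure set T2 -> \bar R}).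
Local Open Scope ereal_scope.

Lemma ae_fst (P : T1 -> Prop) :
  {ae m1, forall x, P x} -> {ae m1 \x m2, forall z, P z.1}.
Proof.
move=> [A [mA A0 PA]]; exists (A `*` setT); split.
- exact: measurableX.
- rewrite -(mul0e (m2 setT)) -A0; exact: product_measure1E.
- by move=> z /= nP; split=> //; exact: PA.
Qed.

Lemma ae_snd (P : T2 -> Prop) :
  {ae m2, forall y, P y} -> {ae m1 \x m2, forall z, P z.2}.
Proof.
move=> [A [mA A0 PA]]; exists (setT `*` A); split.
- exact: measurableX.
- rewrite -(mule0 (m1 setT)) -A0; exact: product_measure1E.
- by move=> z /= nP; split=> //; exact: PA.
Qed.

(** The sections of a null set are almost all null by the definition of the product
    measure. *)
Lemma ae_section (P : T1 * T2 -> Prop) :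
  {ae m1 \x m2, forall z, P z} ->
  {ae m1, forall x, {ae m2, forall y, P (x, y)}}.
Proof.
move=> [A [mA A0 PA]].
have mS : measurable_fun setT (m2 \o xsection A) by exact: measurable_fun_xsection.
have : ae_eq m1 setT (m2 \o xsection A) (cst 0).
  apply/(ae_eq_integral_abs _ measurableT mS); rewrite -[RHS]A0.
  by apply: eq_integral => x _; rewrite gee0_abs.
apply: filterS => x /(_ I) /= Ax0; exists (xsection A x); split=> //.
  exact: measurable_xsection.
by move=> y /= nP; apply/xsectionP; exact: PA.
Qed.

(** Tonelli's theorem when [p] is finite: the norm of [G] is the norm of the function
    mapping [x] to the norm of the section of [G] at [x]. When [p] is infinite the
    latter is almost everywhere at most the former. *)
Lemma Lnorm_sections p (G : T1 * T2 -> R) (k : T1 -> R) (C : R) :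
  1 <= p -> (0 < C)%R -> measurable_fun setT G -> measurable_fun setT k ->
  (forall x, `|(k x)%:E| <= C%:E * 'N[m2]_p[EFin \o (fun y => G (x, y))]) ->
  'N[m1]_p[EFin \o k] <= C%:E * 'N[m1 \x m2]_p[EFin \o G].
Proof.
case: p => [r||//] p1 C0 mG mk kG; last first.
  apply: Lnormy_le; first by rewrite mule_ge0 ?Lnorm_ge0// lee_fin ltW.
  apply: filterS (ae_section (Lnormy_ge (m1 \x m2) G)) => x Gx.
  apply: le_trans (kG x) _; rewrite lee_pmul2l//.
  by apply: Lnormy_le; first exact: Lnorm_ge0.
have r0 : (0 < r)%R by rewrite -lte_fin (lt_le_trans _ p1).
have rN0 : r != 0%R by rewrite gt_eqF.
have mGr := measurable_norm_power r mG.
have i0 x : 0 <= \int[m2]_y (`|(G (x, y))%:E| `^ r).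
  by apply: integral_ge0 => y _; exact: poweR_ge0.
have h : \int[m1]_x (`|(k x)%:E| `^ r) <=
    (C%:E `^ r) * \int[m1 \x m2]_z (`|(G z)%:E| `^ r).
  rewrite (@fubini_tonelli1 _ _ _ _ _ m1 m2 _ mGr (fun z => poweR_ge0 _ _)).
  rewrite /fubini_F -ge0_integralZl//; last 2 first.
  - exact: (@measurable_fun_fubini_tonelli_F _ _ _ _ _ m2 _ mGr
      (fun z => poweR_ge0 _ _)).
  - exact: poweR_ge0.
  apply: ge0_le_integral => //.
  - by move=> x _; exact: poweR_ge0.
  - exact: measurable_norm_power.
  - apply: emeasurable_funM => //.
    exact: (@measurable_fun_fubini_tonelli_F _ _ _ _ _ m2 _ mGr
      (fun z => poweR_ge0 _ _)).
  move=> x _; apply: le_trans (le_poweR (ltW r0) (abse_ge0 _) (kG x)) _.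
  by rewrite poweRM ?Lnorm_ge0 ?lee_fin ?(ltW C0)// poweR_Lnorm.
rewrite !Lnorm_real; apply: le_trans (le_poweR _ _ h) _.
- by rewrite invr_ge0 ltW.
- by apply: integral_ge0 => x _; exact: poweR_ge0.
rewrite poweRM ?poweR_ge0//; last by apply: integral_ge0 => z _; exact: poweR_ge0.
by rewrite -poweRrM mulfV// poweRe1// lee_fin ltW.
Qed.

(** The constant is the power [p^-1] of the measure of [B], increased to be
    positive; for infinite [p] it is 1. *)
Lemma Lp_norm_fst p (A : set T1) (B : set T2) :
  1 <= p -> measurable A -> measurable B -> (p < +oo -> m2 B < +oo) ->
  exists2 C : R, (0 < C)%R & forall f, measurable_fun A f ->
    Lp_norm (m1 \x m2) p (A `*` B) (f \o fst) <= C%:E * Lp_norm m1 p A f.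
Proof.
move=> p1 mA mB hB.
have restrE (f : T1 -> R) : (f \o fst) \_ (A `*` B) =
    fun z : T1 * T2 => ((f \_ A) z.1 * \1_B z.2)%R.
  apply/funext => z; rewrite !patchE in_setX indicE /=.
  by case: (z.1 \in A); case: (z.2 \in B); rewrite ?mulr1 ?mulr0 ?mul0r.
case: p p1 hB => [r||//] p1 hB; last first.
  exists 1%R => // f mf; rewrite mul1e /Lp_norm restrE.
  apply: Lnormy_le; first exact: Lnorm_ge0.
  apply: filterS (ae_fst (Lnormy_ge m1 (f \_ A))) => z; apply: le_trans.
  rewrite !abse_EFin lee_fin normrM ler_piMr// indicE.
  by case: (_ \in _); rewrite ?normr1 ?normr0.
have {}hB := hB (ltry r).
have r0 : (0 < r)%R by rewrite -lte_fin (lt_le_trans _ p1).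
have Bfin : m2 B `^ r^-1 \is a fin_num.
  by rewrite ge0_fin_numE ?poweR_ge0// poweR_lty.
exists (fine (m2 B `^ r^-1) + 1)%R; first by rewrite ltr_wpDl// fine_ge0// poweR_ge0.
move=> f mf; rewrite /Lp_norm restrE !Lnorm_real.
have mfA : measurable_fun setT (f \_ A) by apply/(measurable_restrictT _ mA).1.
have g0 x : 0 <= `|((f \_ A) x)%:E| `^ r by exact: poweR_ge0.
have -> : \int[m1 \x m2]_z (`|((f \_ A) z.1 * \1_B z.2)%:E| `^ r) =
    (\int[m1]_x (`|((f \_ A) x)%:E| `^ r)) * m2 B.
  rewrite -[RHS](@integral_setX_fst _ _ _ _ _ m1 m2 setT B _ measurableT mB
    (measurable_norm_power r mfA) g0).
  rewrite [RHS]integral_mkcond; apply: eq_integral => z _.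
  rewrite [RHS]patchE in_setX in_setT/= indicE; case: (_ \in _); first by rewrite mulr1.
  by rewrite mulr0 /= normr0 powR0// gt_eqF.
rewrite poweRM//; last by apply: integral_ge0.
rewrite [leLHS]muleC lee_wpmul2r ?poweR_ge0// EFinD fineK//.
by rewrite leeDl.
Qed.

Lemma Lp_norm_snd p (A : set T1) (B : set T2) :
  1 <= p -> measurable A -> measurable B -> (p < +oo -> m1 A < +oo) ->
  exists2 C : R, (0 < C)%R & forall f, measurable_fun B f ->
    Lp_norm (m1 \x m2) p (A `*` B) (f \o snd) <= C%:E * Lp_norm m2 p B f.
Proof.
move=> p1 mA mB hA.
have restrE (f : T2 -> R) : (f \o snd) \_ (A `*` B) =
    fun z : T1 * T2 => (\1_A z.1 * (f \_ B) z.2)%R.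
  apply/funext => z; rewrite !patchE in_setX indicE /=.
  by case: (z.1 \in A); case: (z.2 \in B); rewrite ?mul1r ?mulr0 ?mul0r.
case: p p1 hA => [r||//] p1 hA; last first.
  exists 1%R => // f mf; rewrite mul1e /Lp_norm restrE.
  apply: Lnormy_le; first exact: Lnorm_ge0.
  apply: filterS (ae_snd (Lnormy_ge m2 (f \_ B))) => z; apply: le_trans.
  rewrite !abse_EFin lee_fin normrM ler_piMl// indicE.
  by case: (_ \in _); rewrite ?normr1 ?normr0.
have {}hA := hA (ltry r).
have r0 : (0 < r)%R by rewrite -lte_fin (lt_le_trans _ p1).
have Afin : m1 A `^ r^-1 \is a fin_num.
  by rewrite ge0_fin_numE ?poweR_ge0// poweR_lty.
exists (fine (m1 A `^ r^-1) + 1)%R; first by rewrite ltr_wpDl// fine_ge0// poweR_ge0.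
move=> f mf; rewrite /Lp_norm restrE !Lnorm_real.
have mfB : measurable_fun setT (f \_ B) by apply/(measurable_restrictT _ mB).1.
have g0 x : 0 <= `|((f \_ B) x)%:E| `^ r by exact: poweR_ge0.
have -> : \int[m1 \x m2]_z (`|(\1_A z.1 * (f \_ B) z.2)%:E| `^ r) =
    m1 A * (\int[m2]_x (`|((f \_ B) x)%:E| `^ r)).
  rewrite -[RHS](@integral_setX_snd _ _ _ _ _ m1 m2 A setT _ mA measurableT
    (measurable_norm_power r mfB) g0).
  rewrite [RHS]integral_mkcond; apply: eq_integral => z _.
  rewrite [RHS]patchE in_setX in_setT/= indicE andbT.
  case: (_ \in _); first by rewrite mul1r.
  by rewrite mul0r /= normr0 powR0// gt_eqF.
rewrite poweRM//; last by apply: integral_ge0.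
rewrite lee_wpmul2r ?poweR_ge0// EFinD fineK//.
by rewrite leeDl.
Qed.

End product_norms.

Section Lp_norms.
Context {R : realType} d (T : measurableType d) (mu : {measure set T -> \bar R}).
Variables (p : \bar R) (D : set T).
Hypotheses (p1 : (1 <= p)%E) (mD : measurable D).
Local Open Scope ereal_scope.

Lemma LpP (f : T -> R) :
  Lp mu p D f <-> measurable_fun D f /\ Lp_norm mu p D f < +oo.
Proof.
split=> [/andP[]|[mf nf]].
  rewrite !inE/= => mf nf; split=> //.
  exact/(measurable_restrictT _ mD).2.
by apply/andP; rewrite !inE/=; split=> //; exact/(measurable_restrictT _ mD).1.
Qed.

Lemma Lp_norm_ge0 (f : T -> R) : 0 <= Lp_norm mu p D f.
Proof. exact: Lnorm_ge0. Qed.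

Lemma le_Lp_norm (f g : T -> R) : measurable_fun D f -> measurable_fun D g ->
  {ae mu, forall x, D x -> (`|f x| <= `|g x|)%R} ->
  Lp_norm mu p D f <= Lp_norm mu p D g.
Proof.
move=> mf mg fg; apply: le_Lnorm => //.
- exact/(measurable_restrictT _ mD).1.
- exact/(measurable_restrictT _ mD).1.
apply: filterS fg => x fg; rewrite !patchE.
by case: ifPn => // /set_mem/fg.
Qed.

Lemma Lp_normD (f g : T -> R) : measurable_fun D f -> measurable_fun D g ->
  Lp_norm mu p D (f \+ g)%R <= Lp_norm mu p D f + Lp_norm mu p D g.
Proof.
move=> mf mg; rewrite /Lp_norm.
have -> : ((f \+ g) \_ D)%R = ((f \_ D) \+ (g \_ D))%R.
  by apply/funext => x; rewrite /= !patchE; case: ifP; rewrite ?addr0.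
by apply: eminkowski => //; exact/(measurable_restrictT _ mD).1.
Qed.

Lemma Lp_norm_cst : (p < +oo -> mu D < +oo) ->
  exists2 C : R, (0 < C)%R & forall c : R, Lp_norm mu p D (cst c) <= (C * `|c|)%:E.
Proof.
move=> hD.
have restrE (c : R) : (cst c) \_ D = (fun x => c * \1_D x)%R.
  by apply/funext => x; rewrite patchE indicE; case: (_ \in _); rewrite ?mulr1 ?mulr0.
have := p1; case: p hD => [r||//] hD r1; last first.
  exists 1%R => // c; rewrite mul1r /Lp_norm restrE; apply: Lnormy_le => //.
  apply: nearW => x; rewrite abse_EFin lee_fin normrM ler_piMr// indicE.
  by case: (_ \in _); rewrite ?normr1 ?normr0.
have {}hD := hD (ltry r).
have r0 : (0 < r)%R by rewrite -lte_fin (lt_le_trans _ r1).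
have Dfin : mu D `^ r^-1 \is a fin_num.
  by rewrite ge0_fin_numE ?poweR_ge0// poweR_lty.
exists (fine (mu D `^ r^-1) + 1)%R; first by rewrite ltr_wpDl// fine_ge0// poweR_ge0.
move=> c; rewrite /Lp_norm restrE Lnorm_real.
have -> : \int[mu]_x (`|(c * \1_D x)%:E| `^ r) = (`|c| `^ r)%:E * mu D.
  rewrite -[RHS](integral_cst mu mD) [RHS]integral_mkcond; apply: eq_integral => x _.
  rewrite patchE indicE; case: (_ \in _); first by rewrite mulr1.
  by rewrite mulr0 /= normr0 powR0// gt_eqF.
rewrite poweRM ?lee_fin ?powR_ge0// poweR_EFin -powRrM mulfV ?gt_eqF//.
rewrite powRr1// muleC EFinM lee_wpmul2r// ?lee_fin// EFinD fineK//.
by rewrite leeDl.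
Qed.

End Lp_norms.

(** * Estimates of the two gradients *)

Section euclidean.
Context {R : realType} {N : nat}.
Implicit Types v : 'rV[R]_N.

Lemma euclidean_norm_ge0 v : 0 <= euclidean_norm v.
Proof. exact: sqrtr_ge0. Qed.

Lemma coord_le_euclidean v i : `|v ord0 i| <= euclidean_norm v.
Proof.
rewrite -sqrtr_sqr ler_sqrt; last by apply: sumr_ge0 => j _; exact: sqr_ge0.
by rewrite (bigD1 i)//= lerDl; apply: sumr_ge0 => j _; exact: sqr_ge0.
Qed.

Lemma euclidean_le_sum v : euclidean_norm v <= \sum_(i < N) `|v ord0 i|.
Proof.
have s0 : 0 <= \sum_(i < N) `|v ord0 i| by exact: sumr_ge0.
rewrite -[leRHS]ger0_norm// -sqrtr_sqr ler_sqrt ?sqr_ge0// expr2 mulr_suml.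
apply: ler_sum => i _; rewrite -real_normK ?num_real// expr2 ler_wpM2l//.
by rewrite (bigD1 i)//= lerDl sumr_ge0.
Qed.

End euclidean.

Section vector_norms.
Context {R : realType} d (T : measurableType d) (mu : {measure set T -> \bar R}).
Variables (p : \bar R) (D : set T) (N : nat).
Hypotheses (p1 : (1 <= p)%E) (mD : measurable D).
Implicit Type F : T -> 'rV[R]_N.

Lemma measurable_fun_rV_in F :
  (forall i, measurable_fun D (fun x => F x ord0 i)) -> measurable_fun D F.
Proof.
move=> mF; pose G x : 'rV[R]_N := \row_i ((fun x => F x ord0 i) \_ D) x.
have mG : measurable_fun setT G.
  apply: measurable_fun_rV => i; under eq_fun do rewrite mxE.
  exact/(measurable_restrictT _ mD).1.
apply: (eq_measurable_fun G) (measurable_funTS mG) => x xD.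
by apply/rowP => i; rewrite mxE patchE xD.
Qed.

Lemma measurable_euclidean F :
  (forall i, measurable_fun D (fun x => F x ord0 i)) ->
  measurable_fun D (@euclidean_norm R N \o F).
Proof.
move=> mF; rewrite /euclidean_norm.
have ms : measurable_fun D (fun x => \sum_(i < N) F x ord0 i ^+ 2).
  by apply: measurable_sum => i; exact: measurable_funX.
apply: (measurableT_comp (f := @Num.sqrt R)) ms.
by apply: continuous_measurable_fun; exact: sqrt_continuous.
Qed.

Lemma Lp_norm_coord_le F i :
  (forall i, measurable_fun D (fun x => F x ord0 i)) ->
  (Lp_norm mu p D (fun x => F x ord0 i) <= Lp_norm_vec mu p D F)%E.
Proof.
move=> mF; apply: le_Lp_norm => //; first exact: measurable_euclidean.
apply: nearW => x Dx /=; rewrite [leRHS]ger0_norm ?euclidean_norm_ge0//.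
exact: coord_le_euclidean.
Qed.

(** Minkowski's inequality and the bound of the Euclidean norm by the sum of the
    coordinates reduce estimates of vector fields to scalar ones. *)
Lemma Lp_norm_vec_le_sum F :
  (forall i, measurable_fun D (fun x => F x ord0 i)) ->
  (Lp_norm_vec mu p D F <= \sum_(i < N) Lp_norm mu p D (fun x => F x ord0 i))%E.
Proof.
move=> mF; pose S (s : seq 'I_N) x := \sum_(i <- s) `|F x ord0 i|.
have mS s : measurable_fun D (S s).
  by apply: measurable_sum => i; exact: measurableT_comp.
have h s : (Lp_norm mu p D (S s) <=
    \sum_(i <- s) Lp_norm mu p D (fun x => F x ord0 i))%E.
  elim: s => [|i s IH].
    rewrite big_nil /Lp_norm (_ : S [::] \_ D = cst 0).
      by rewrite Lnorm0// gt_eqF// (lt_le_trans _ p1)// lte01.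
    by apply/funext => x; rewrite patchE /S big_nil; case: ifP.
  rewrite big_cons.
  have -> : S (i :: s) = ((fun x => `|F x ord0 i|) \+ S s)%R.
    by apply/funext => x; rewrite /S big_cons.
  have mi : measurable_fun D (fun x => `|F x ord0 i|) by exact: measurableT_comp.
  apply: le_trans (Lp_normD mu p1 mD mi (mS s)) _; apply: leeD => //.
  by apply: le_Lp_norm => //; apply: nearW => x _; rewrite normr_id.
apply: le_trans (h _); apply: le_Lp_norm => //; first exact: measurable_euclidean.
apply: nearW => x _ /=; rewrite !ger0_norm ?euclidean_norm_ge0 ?sumr_ge0//.
exact: euclidean_le_sum.
Qed.

Lemma Lp_norm_vec_le F (C : 'I_N -> R) (X : \bar R) : (0 <= X)%E ->
  (forall i, 0 <= C i) ->
  (forall i, measurable_fun D (fun x => F x ord0 i)) ->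
  (forall i, Lp_norm mu p D (fun x => F x ord0 i) <= (C i)%:E * X)%E ->
  (Lp_norm_vec mu p D F <= (\sum_(i < N) C i)%:E * X)%E.
Proof.
move=> X0 C0 mF h; apply: le_trans (Lp_norm_vec_le_sum mF) _.
rewrite -sumEFin ge0_sume_distrl; last by move=> i _; rewrite lee_fin.
by apply: lee_sum => i _; exact: h.
Qed.

End vector_norms.

Section estimates.
Context {R : realType} {N : nat}.
Local Notation RN := 'rV[R]_N.
Local Notation leb := (@lebesgue_rV R N).
Local Notation leb2 := (leb \x leb)%E.
Variables (p : \bar R) (D : set RN).
Hypotheses (p1 : (1 <= p)%E) (oD : open D) (hD : (p < +oo -> leb D < +oo)%E).

Let mD : measurable D := open_measurable_rV oD.

Lemma Cc_pairing (h : RN -> R) : Cc D h ->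
  exists2 C : R, 0 < C & forall u : RN -> R, measurable_fun [set: RN] u ->
    (\int[leb]_x `|(u x * h x)%:E| <= C%:E * 'N[leb]_p[EFin \o u])%E.
Proof.
move=> Ch; have [M M0 hM] := Cc_bounded Ch; have [ch [K [cK KD h0]]] := Ch.
apply: (@Lnorm_pairing _ _ _ leb p K h M) => //.
- exact: compact_measurable_rV.
- exact: lebesgue_compact_lty.
- exact: continuous_measurable_rV.
Qed.

Lemma Rintegral_pairing (h : RN -> R) : Cc D h ->
  exists2 C : R, 0 < C & forall u : RN -> R, measurable_fun D u ->
    (`|\int[leb]_(x in D) (u x * h x)|%:E <= C%:E * Lp_norm leb p D u)%E.
Proof.
move=> Ch; have [C C0 hC] := Cc_pairing Ch; exists C => // u mu0.
have muD : measurable_fun setT (u \_ D) by exact: (measurable_restrictT u mD).1 mu0.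
apply: le_trans (hC _ muD); rewrite Rintegral_mkcond.
have -> : (fun x => u x * h x) \_ D = (fun x => (u \_ D) x * h x).
  by apply/funext => x; rewrite !patchE; case: ifP; rewrite ?mul0r.
have mh : measurable_fun setT h by apply: continuous_measurable_rV; exact: Ch.1.
have fine_le (X : \bar R) : (`|fine X|%:E <= `|X|)%E.
  by case: X => [r| |]//=; rewrite normr0 leey.
apply: le_trans (fine_le _) _; apply: le_abse_integral => //.
by apply/measurable_EFinP; exact: measurable_funM.
Qed.

(** Pairing with [eta] bounds the mean of a section by the norm of the section, and
    [Lnorm_sections] integrates this bound. *)
Lemma Lp_norm_section_mean (eta : RN -> R) : Cc D eta ->
  exists2 C : R, 0 < C & forall g : RN * RN -> R, measurable_fun (D `*` D) g ->
    (Lp_norm leb p D (section_mean D g eta) <= C%:E * Lp_norm leb2 p (D `*` D) g)%E.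
Proof.
move=> Ce; have [C C0 hC] := Rintegral_pairing Ce; exists C => // g mg.
have me : measurable_fun [set: RN] eta by apply: continuous_measurable_rV; exact: Ce.1.
have mDD := measurableX mD mD.
have mgD : measurable_fun setT (g \_ (D `*` D)).
  exact: (measurable_restrictT g mDD).1 mg.
have ms : measurable_fun D (section_mean D g eta).
  apply: (@measurable_Rintegral12 _ _ _ _ _ leb D D (fun z => g z * eta z.2)) => //.
  by apply: measurable_funM => //; apply: measurable_funTS; exact: measurableT_comp.
apply: Lnorm_sections => //; first exact: (measurable_restrictT _ mD).1 ms.
move=> x; rewrite patchE; case: ifPn => [/set_mem Dx|_]; last first.
  by rewrite abse0 mule_ge0 ?Lnorm_ge0// lee_fin ltW.
have mgx : measurable_fun D (fun y => g (x, y)).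
  apply: (measurable_comp mDD _ mg); first by move=> _ [y Dy <-].
  by apply: measurable_funTS; exact: pair1_measurable.
apply: le_trans (hC _ mgx) _.
rewrite /Lp_norm (_ : (fun y => g (x, y)) \_ D = fun y => (g \_ (D `*` D)) (x, y))//.
by apply/funext => y; rewrite !patchE in_setX/= (mem_set Dx).
Qed.

Lemma Lp_norm_difference : exists2 C : R, 0 < C &
  forall v : RN -> R, measurable_fun D v ->
  (Lp_norm leb2 p (D `*` D) (fun z => v z.2 - v z.1)%R <= C%:E * Lp_norm leb p D v)%E.
Proof.
have [C1 C10 h1] := @Lp_norm_fst _ _ _ _ _ leb leb p D D p1 mD mD hD.
have [C2 C20 h2] := @Lp_norm_snd _ _ _ _ _ leb leb p D D p1 mD mD hD.
exists (C2 + C1) => [|v mv]; first exact: addr_gt0.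
have mDD := measurableX mD mD.
have mv2 : measurable_fun (D `*` D) (v \o snd).
  apply: (measurable_comp mD) mv _; last exact: measurable_funTS.
  by move=> _ [z [_ ?] <-].
have mv1 : measurable_fun (D `*` D) (v \o fst).
  apply: (measurable_comp mD) mv _; last exact: measurable_funTS.
  by move=> _ [z [? _] <-].
have mNv1 : measurable_fun (D `*` D) (\- (v \o fst)) by exact: measurableT_comp.
apply: le_trans (Lp_normD leb2 p1 mDD mv2 mNv1) _.
rewrite EFinD ge0_muleDl ?lee_fin ?(ltW C10) ?(ltW C20)//.
apply: leeD; first exact: h2.
apply: le_trans (h1 _ mv); apply: le_Lp_norm => //.
by apply: nearW => z _ /=; rewrite normrN.
Qed.

(** The first term is a constant function, bounded by the pairing of [u] with
    [D_i eta]; the second one is a mean of sections. *)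
Lemma Lp_norm_recovered i (eta : RN -> R) : C1c D eta ->
  exists2 C : R, 0 < C & forall (u : RN -> R) (g : RN * RN -> R),
    measurable_fun D u -> measurable_fun (D `*` D) g ->
    (Lp_norm leb p D (fun x =>
      - (\int[leb]_(x in D) (u x * 'D_(basis_vec i) eta x)) - section_mean D g eta x)%R
    <= C%:E * (Lp_norm leb p D u + Lp_norm leb2 p (D `*` D) g))%E.
Proof.
move=> ceta; have [_ Ceta] := (C1cP _ _).1 ceta.
have [C1 C10 h1] := @Lp_norm_cst _ _ _ leb p D p1 mD hD.
have [C2 C20 h2] := Rintegral_pairing (C1c_derive (basis_vec i) ceta).
have [C3 C30 h3] := Lp_norm_section_mean Ceta.
exists (C1 * C2 + C3) => [|u g mu0 mg]; first by rewrite addr_gt0// mulr_gt0.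
set c := \int[leb]_(x in D) _.
have mDD := measurableX mD mD.
have me : measurable_fun [set: RN] eta.
  by apply: continuous_measurable_rV; exact: Ceta.1.
have ms : measurable_fun D (section_mean D g eta).
  apply: (@measurable_Rintegral12 _ _ _ _ _ leb D D (fun z => g z * eta z.2)) => //.
  by apply: measurable_funM => //; apply: measurable_funTS; exact: measurableT_comp.
have mNs : measurable_fun D (\- section_mean D g eta) by exact: measurableT_comp.
have mc : measurable_fun D (cst (- c)) by exact: measurable_cst.
apply: le_trans (Lp_normD leb p1 mD mc mNs) _.
have U0 := Lp_norm_ge0 leb p D u; have G0 := Lp_norm_ge0 leb2 p (D `*` D) g.
have [C1' C2' C3'] := And3 (ltW C10) (ltW C20) (ltW C30).
rewrite ge0_muleDr// EFinD !ge0_muleDl ?lee_fin ?mulr_ge0//.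
have e1 : (Lp_norm leb p D (cst (- c)%R) <= (C1 * C2)%:E * Lp_norm leb p D u)%E.
  apply: le_trans (h1 _) _; rewrite normrN !EFinM -muleA.
  by apply: lee_wpmul2l; [rewrite lee_fin|exact: h2].
have e2 : (Lp_norm leb p D (\- section_mean D g eta)%R <=
    C3%:E * Lp_norm leb2 p (D `*` D) g)%E.
  apply: le_trans (h3 _ mg); apply: le_Lp_norm => //.
  by apply: nearW => z _ /=; rewrite normrN.
apply: leeD.
  by apply: le_trans e1 _; rewrite leeDl// mule_ge0// lee_fin ltW.
by apply: le_trans e2 _; rewrite leeDr// mule_ge0// lee_fin mulr_ge0// ltW.
Qed.

End estimates.

(** * Equivalence of the two spaces *)

Section vector_Lp.
Context {R : realType} d (T : measurableType d) (mu : {measure set T -> \bar R}).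
Variables (p : \bar R) (D : set T) (N : nat).
Hypotheses (p1 : (1 <= p)%E) (mD : measurable D).
Implicit Types F G : T -> 'rV[R]_N.

Lemma Lp_vec_coordP F : (forall i, measurable_fun D (fun x => F x ord0 i)) ->
  (Lp_norm_vec mu p D F < +oo)%E -> Lp_vec mu p D F.
Proof.
move=> mF nF; split; first exact: measurable_fun_rV_in.
by apply/LpP => //; split=> //; exact: measurable_euclidean.
Qed.

Lemma eq_Lp_norm_vec F G :
  (forall i, measurable_fun D (fun x => F x ord0 i)) ->
  (forall i, measurable_fun D (fun x => G x ord0 i)) ->
  (forall i, {ae mu, forall x, D x -> F x ord0 i = G x ord0 i}) ->
  Lp_norm_vec mu p D F = Lp_norm_vec mu p D G.
Proof.
move=> mF mG FG.
have FGae : {ae mu, forall x, D x -> F x = G x}.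
  have : {ae mu, forall x i, D x -> F x ord0 i = G x ord0 i}.
    exact: filter_forall FG.
  by apply: filterS => x h Dx; apply/rowP => i; exact: h.
by apply: le_anti; apply/andP; split; apply: le_Lp_norm => //;
  try exact: measurable_euclidean; apply: filterS FGae => x h /h /= ->.
Qed.

End vector_Lp.

Section equivalence.
Context {R : realType} {N : nat}.
Local Notation RN := 'rV[R]_N.
Local Notation leb := (@lebesgue_rV R N).
Local Notation leb2 := (leb \x leb)%E.
Variables (p : \bar R) (D : set RN).
Hypotheses (p1 : (1 <= p)%E) (oD : open D) (hD : (p < +oo -> leb D < +oo)%E).

Let mD : measurable D := open_measurable_rV oD.

Lemma weak_gradient_measurable u G i :
  is_weak_gradient D u G -> measurable_fun D (fun x => G x ord0 i).
Proof. by move=> /(_ i)[_ [mG _] _]. Qed.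

Lemma nonlocal_gradient_measurable u G i :
  is_nonlocal_gradient D u G -> measurable_fun (D `*` D) (fun z => G z ord0 i).
Proof. by move=> /(_ i)[_ [mG _] _]. Qed.

Lemma nonlocal_gradient_of_weak : exists2 C : R, 0 <= C &
  forall u G, is_weak_gradient D u G ->
    is_nonlocal_gradient D u (fun z => G z.2 - G z.1) /\
    (Lp_norm_vec leb2 p (D `*` D) (fun z => G z.2 - G z.1)%R <=
     C%:E * Lp_norm_vec leb p D G)%E.
Proof.
have [C C0 hC] := Lp_norm_difference p1 oD hD.
exists (\sum_(i < N) C) => [|u G wG]; first by apply: sumr_ge0 => i _; exact: ltW.
have coordE i : (fun z : RN * RN => (G z.2 - G z.1) ord0 i) =
    (fun z => G z.2 ord0 i - G z.1 ord0 i).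
  by apply/funext => z; rewrite !mxE.
have nG : is_nonlocal_gradient D u (fun z => G z.2 - G z.1).
  by move=> i; rewrite coordE; exact: (weak_to_nonlocal oD (wG i)).
split=> //; apply: Lp_norm_vec_le => //.
- exact: measurableX.
- exact: Lp_norm_ge0.
- by move=> _; exact: ltW.
- by move=> i; exact: nonlocal_gradient_measurable nG.
move=> i; rewrite coordE.
have mG j := weak_gradient_measurable j wG.
apply: le_trans (hC _ (mG i)) _; rewrite lee_pmul2l//.
exact: Lp_norm_coord_le.
Qed.

(** The constant of [Lp_norm_recovered] depends on [eta], which can be fixed before
    [u]. *)
Lemma weak_gradient_of_nonlocal : D !=set0 -> exists2 C : R, 0 <= C &
  forall u G, measurable_fun D u -> is_nonlocal_gradient D u G ->
    exists2 H, is_weak_gradient D u H &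
    (Lp_norm_vec leb p D H <=
     C%:E * (Lp_norm leb p D u + Lp_norm_vec leb2 p (D `*` D) G))%E.
Proof.
move=> D0; have [eta ceta eta1] := exists_unit_C1c oD D0.
have /choice[C hC] : forall i : 'I_N, exists C : R, 0 < C /\
    forall (u : RN -> R) (g : RN * RN -> R),
    measurable_fun D u -> measurable_fun (D `*` D) g ->
    (Lp_norm leb p D (fun x =>
      - (\int[leb]_(x in D) (u x * 'D_(basis_vec i) eta x)) - section_mean D g eta x)%R
    <= C%:E * (Lp_norm leb p D u + Lp_norm leb2 p (D `*` D) g))%E.
  by move=> i; have [C C0 h] := Lp_norm_recovered p1 oD hD i ceta; exists C.
have C0 i : 0 < C i by have [] := hC i.
exists (\sum_(i < N) C i) => [|u G mu0 nG]; first by apply: sumr_ge0 => i _; exact: ltW.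
pose H x : RN := \row_i (- (\int[leb]_(x in D) (u x * 'D_(basis_vec i) eta x))
  - section_mean D (fun z => G z ord0 i) eta x).
have HE i : (fun x => H x ord0 i) = fun x =>
    - (\int[leb]_(x in D) (u x * 'D_(basis_vec i) eta x))
    - section_mean D (fun z => G z ord0 i) eta x.
  by apply/funext => x; rewrite mxE.
have wH : is_weak_gradient D u H.
  by move=> i; rewrite HE; exact: nonlocal_to_weak (nG i).
have mG i := nonlocal_gradient_measurable i nG.
have mDD := measurableX mD mD.
exists H => //; apply: Lp_norm_vec_le => //.
- by rewrite adde_ge0//; exact: Lp_norm_ge0.
- by move=> i; exact: ltW.
- by move=> i; exact: weak_gradient_measurable wH.
move=> i; rewrite HE; apply: le_trans ((hC i).2 _ _ mu0 (mG i)) _.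
apply: lee_wpmul2l; first by rewrite lee_fin ltW.
apply: leeD; first exact: lexx.
exact: (Lp_norm_coord_le leb2 p1 mDD i mG).
Qed.

End equivalence.

Unset Implicit Arguments.

Theorem theorem1p2 (R : realType) (N : nat) (p : \bar R)
    (Omega : set 'rV[R]_N)
    (hp : (1 <= p)%E)
    (hopen : open Omega)
    (hnonempty : Omega !=set0)
    (hfinite : (p < +oo)%E -> (lebesgue_rV N Omega < +oo)%E) :
  nonlocal_sobolev p Omega = sobolev p Omega /\
  equivalent_norms (sobolev p Omega) (sobolev_norm p Omega)
    (nonlocal_sobolev_norm p Omega).
Proof.
have mO := open_measurable_rV hopen; have mOO := measurableX mO mO.
set leb := @lebesgue_rV R N; set leb2 := (leb \x leb)%E.
have [A A0 to_nonlocal] := nonlocal_gradient_of_weak hp hopen hfinite.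
have [B B0 to_weak] := weak_gradient_of_nonlocal hp hopen hfinite hnonempty.
have lty (C : R) (X : \bar R) :
    0 <= C -> (0 <= X)%E -> (X < +oo)%E -> (C%:E * X < +oo)%E.
  by move=> C0 X0 Xoo; rewrite lte_mul_pinfty.
split.
  apply/seteqP; split=> u [Lu [G gG LG]]; split=> //.
    have [mu0 uoo] := (LpP leb p mO u).1 Lu.
    have [H wH Hle] := to_weak u G mu0 gG; exists H => //.
    apply: Lp_vec_coordP => // [i|]; first exact: weak_gradient_measurable wH.
    apply: le_lt_trans Hle _; apply: lty => //; first by rewrite adde_ge0// Lp_norm_ge0.
    by rewrite lte_add_pinfty//; have [] := (LpP leb2 p mOO _).1 LG.2.
  have [nG Gle] := to_nonlocal u G gG; exists (fun z => G z.2 - G z.1) => //.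
  apply: Lp_vec_coordP => // [i|]; first exact: nonlocal_gradient_measurable nG.
  apply: le_lt_trans Gle _; apply: lty => //; first exact: Lp_norm_ge0.
  by have [] := (LpP leb p mO _).1 LG.2.
exists (1 + B)^-1, (1 + A); split; [by rewrite invr_gt0 ltr_pwDl|by rewrite ltr_pwDl|].
move=> u [Lu [G0 wG0 _]]; have [mu0 uoo] := (LpP leb p mO u).1 Lu.
rewrite /sobolev_norm /nonlocal_sobolev_norm -/leb -/leb2.
set G := weak_gradient Omega u; set H := nonlocal_gradient Omega u.
have wG : is_weak_gradient Omega u G by apply: xgetPex; exists G0.
have [nG Gle] := to_nonlocal u G wG.
have nH : is_nonlocal_gradient Omega u H by apply: xgetPex; eexists; exact: nG.
have [K wK Kle] := to_weak u H mu0 nH.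
have GK : Lp_norm_vec leb p Omega G = Lp_norm_vec leb p Omega K.
  apply: eq_Lp_norm_vec => // i.
  - exact: weak_gradient_measurable wG.
  - exact: weak_gradient_measurable wK.
  - exact: weak_partial_unique (wG i) (wK i).
have HG : Lp_norm_vec leb2 p (Omega `*` Omega) H =
    Lp_norm_vec leb2 p (Omega `*` Omega) (fun z => G z.2 - G z.1).
  apply: eq_Lp_norm_vec => // i.
  - exact: nonlocal_gradient_measurable nH.
  - exact: nonlocal_gradient_measurable nG.
  - exact: nonlocal_partial_unique (nH i) (nG i).
have U0 := Lp_norm_ge0 leb p Omega u.
have V0 : (0 <= Lp_norm_vec leb p Omega G)%E by exact: Lp_norm_ge0.
have W0 : (0 <= Lp_norm_vec leb2 p (Omega `*` Omega) H)%E by exact: Lp_norm_ge0.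
have add1 (C : R) (X Y : \bar R) : 0 <= C -> (0 <= X)%E -> (0 <= Y)%E ->
    (X + C%:E * (X + Y) <= (1 + C)%:E * (X + Y))%E.
  move=> C0 X0 Y0; rewrite EFinD ge0_muleDl ?lee_fin// mul1e.
  by apply: leeD => //; rewrite leeDl.
split.
  rewrite lee_pdivrMl ?ltr_pwDl// GK; apply: le_trans (leeD (lexx _) Kle) _.
  exact: add1.
rewrite HG; apply: le_trans (leeD (lexx _) Gle) _.
apply: le_trans (add1 _ _ _ A0 U0 V0).
by apply: leeD => //; rewrite lee_wpmul2l ?lee_fin// leeDr.
Qed.
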